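(* There is a combinatorial algorithm that, given a connected simple graph $G$ with $n$ vertices and $m$ edges where $1\le m \leq 2n$, runs in $O(n)$ time and outputs a cut of $G$ of size at least $\left(\frac{1}{2}+\frac{n}{2m}\right)\cdot mc(G)$.
   Context: Graphs are finite, simple, unweighted and connected (the paper considers only connected input graphs). For a graph $G=(V,E)$ and a partition $A,B$ of $V$, the cut $C(A,B)$ has size $|\{\{u,v\}\in E : u\in A, v\in B\}|$. $mc(G)$ denotes the maximum size of a cut of $G$. A combinatorial algorithm is one that does not use numerical operations such as matrix operations or eigenvalue computations as subroutines.
   Formalization: The factor 1/2 + n/(2m) is replaced by min(1, 1/2 + n/(2m)): for trees (m = n − 1, e.g. K_2) the stated factor exceeds 1, so no cut attains it, and a maximum cut is required instead; for m ≥ n the bound is unchanged. *)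

(* Defs.v *)
From mathcomp Require Import all_boot all_order all_algebra.

Set Implicit Arguments.
Unset Strict Implicit.
Unset Printing Implicit Defensive.

Section Cuts.

Variables (T : finType) (e : rel T).

Definition edges : {set {set T}} :=
  [set [set p.1; p.2] | p : T * T & e p.1 p.2].

Definition cut (A B : {set T}) : {set {set T}} :=
  [set [set p.1; p.2] | p : T * T & [&& e p.1 p.2, p.1 \in A & p.2 \in B]].

Definition mc : nat := \max_(A : {set T}) #|cut A (~: A)|.

Definition connected_graph : Prop := forall u v : T, connect e u v.

(* [N v] lists the neighbours of [v], once each, in an arbitrary order. *)
Definition adjacency_lists (N : T -> seq T) : Prop :=
  forall v, uniq (N v) /\ N v =i e v.

End Cuts.

(* The model of computation is a unit-cost successor RAM, programmed with
   structured control flow: finitely many registers and arrays of natural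
   numbers, indirect addressing, comparisons, and +1 / -1 as the only
   arithmetic.  A program is a finite piece of syntax, independent of its input.
   Having no other arithmetic makes every program combinatorial, and makes the
   unit-cost measure fair: a run of t steps raises the largest number in memory
   by O(t) only, so linear-time runs manipulate O(log n)-bit words. *)

Inductive aexp : Type :=
  | Const of nat
  | Reg of nat
  | Read of nat & aexp           (* array name, index *)
  | Succ of aexp
  | Pred of aexp.

Inductive bexp : Type :=
  | Eq of aexp & aexp
  | Lt of aexp & aexp
  | Not of bexp
  | And of bexp & bexp.

Inductive com : Type :=
  | Skip
  | Assign of nat & aexp
  | Store of nat & aexp & aexp   (* array name, index, value *)
  | Seq of com & com
  | If of bexp & com & com
  | While of bexp & com.

Record state : Type := State { reg : nat -> nat; arr : nat -> nat -> nat }.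

Fixpoint aeval (s : state) (a : aexp) : nat :=
  match a with
  | Const k => k
  | Reg x => reg s x
  | Read b i => arr s b (aeval s i)
  | Succ a => (aeval s a).+1
  | Pred a => (aeval s a).-1
  end.

Fixpoint beval (s : state) (b : bexp) : bool :=
  match b with
  | Eq a1 a2 => aeval s a1 == aeval s a2
  | Lt a1 a2 => aeval s a1 < aeval s a2
  | Not b => ~~ beval s b
  | And b1 b2 => beval s b1 && beval s b2
  end.

Definition set_reg (s : state) (x v : nat) : state :=
  State (fun y => if y == x then v else reg s y) (arr s).

Definition set_arr (s : state) (b i v : nat) : state :=
  State (reg s)
        (fun c j => if (c == b) && (j == i) then v else arr s c j).

(* [exec c s s' t]: started in [s], [c] halts in [s'] after [t] steps.  Each
   executed assignment, store or test is one step; the expressions it evaluates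
   have a size fixed by the program, so this is the number of elementary
   operations up to a factor depending on the program only. *)
Inductive exec : com -> state -> state -> nat -> Prop :=
  | exec_skip s : exec Skip s s 1
  | exec_assign x a s : exec (Assign x a) s (set_reg s x (aeval s a)) 1
  | exec_store b i a s :
      exec (Store b i a) s (set_arr s b (aeval s i) (aeval s a)) 1
  | exec_seq c1 c2 s1 s2 s3 t1 t2 :
      exec c1 s1 s2 t1 -> exec c2 s2 s3 t2 -> exec (Seq c1 c2) s1 s3 (t1 + t2)
  | exec_if_true b c1 c2 s s' t :
      beval s b -> exec c1 s s' t -> exec (If b c1 c2) s s' t.+1
  | exec_if_false b c1 c2 s s' t :
      ~~ beval s b -> exec c2 s s' t -> exec (If b c1 c2) s s' t.+1
  | exec_while_true b c s1 s2 s3 t1 t2 :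
      beval s1 b -> exec c s1 s2 t1 -> exec (While b c) s2 s3 t2 ->
      exec (While b c) s1 s3 (t1 + t2).+1
  | exec_while_false b c s : ~~ beval s b -> exec (While b c) s s 1.

(* Memory initially holding the adjacency lists [N] of a graph on {0,...,n-1}:
   register 0 contains n, array 1 the concatenation of the lists of the vertices
   0, ..., n-1, and array 0 the n+1 offsets delimiting them: the list of v
   occupies the cells i of array 1 with arr 0 v <= i < arr 0 (v+1).  Everything
   else is 0. *)
Definition input_state (n : nat) (N : 'I_n -> seq 'I_n) : state :=
  State (fun x => if x == 0 then n else 0)
        (fun b => match b with
         | 0 => nth 0 (0 :: scanl addn 0 [seq size (N v) | v <- enum 'I_n])
         | 1 => nth 0 (flatten [seq map val (N v) | v <- enum 'I_n])
         | _ => fun=> 0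
         end).

(* The side of the cut described by the final memory: the vertices marked by a
   nonzero entry of array 2. *)
Definition output_side (n : nat) (s : state) : {set 'I_n} :=
  [set v : 'I_n | arr s 2 v != 0].

(* Main.v *)
(* Colour the vertices by the parity of their depth in a depth-first tree; all
   edges join a vertex to an ancestor, and the "bad" ones have ends of the same
   parity.  Going up the tree, cut off the subtree still hanging below [v] from
   its parent as soon as it has a bad edge to that parent.  This yields connected
   bipartite pieces, and each of the [q] cuts comes with an odd cycle inside a
   piece together with the parent of its root.  These cycles are edge-disjoint,
   so every cut of the graph misses at least [q] edges.  Inside the pieces at
   least [n - 1 - q] edges are cut, and turning the pieces over one after the
   other, by majority, cuts half of the others, so that at most
   [(m - n + 1 + q) / 2] edges are missed.  Let [k >= q] be the number of edges
   missed by a maximum cut.  Since [m <= 2n], this bound suffices, except when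
   [q = k = 1] and the two pieces are induced trees.  Then all odd cycles share
   an edge, and if it is a tree edge, no good non-tree edge starts below it
   whereas all the bad ones do.  A second candidate cut therefore switches the
   branches whose non-tree edges to ancestors are all bad; in this case it misses
   a single edge.  The program outputs the better of the two cuts. *)

Require Import Defs.
From mathcomp Require Import all_boot all_order all_algebra zify ring.

Set Implicit Arguments.
Unset Strict Implicit.
Unset Printing Implicit Defensive.

Import Order.TTheory GRing.Theory Num.Theory.

(** * Cuts and depth-first trees *)

(** Everything is measured in missed edges. A cut missing [l] edges has the required ratio to one
    missing [k] when [2ml + mn <= m^2 + k(m + n)]. The majority cut satisfies [2l + n <= m + 1 + q];
    multiplied by [m], this leaves [m + mq <= km + kn]. Since [q <= k], it is enough that [m <= kn],
    so [m <= 2n] settles [k >= 2]. If [q = 0] there is a single bipartite piece and nothing is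
    missed, so only [q = k = 1] remains; there a non-tree edge inside a piece improves the majority
    bound by one, which is again enough. The obstacle in the last case is that the program does not
    know an optimal cut. An arbitrary labelling [s] missing one edge [(w, y)] appears only in the
    analysis, where comparing [s] with the depth parity shows where the bad edges and the good
    non-tree edges can lie. The program itself only needs [req] and [g], both computable in one pass
    up the tree. *)

Definition anc (T : finType) (p : T -> T) (a b : T) : bool := fconnect p b a.

(** Depths start at 1, which frees 0 to mean an unvisited vertex during the search and the absence
    of bad edges in [req]. The root is its own parent, so [p] is total. *)
Record dfs_tree (T : finType) (e : rel T) (r : T) (p : T -> T)
    (dep : T -> nat) : Prop := DfsTree {
  tree_root : p r = r;
  dep_root : dep r = 1;
  tree_edge : forall v, v != r -> e v (p v);
  dep_parent : forall v, v != r -> dep v = (dep (p v)).+1;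
  edge_anc : forall x y, e x y -> anc p x y || anc p y x
}.

Section UpEdges.

Variables (T : finType) (e : rel T) (dep : T -> nat).
Hypothesis e_sym : symmetric e.
Hypothesis dep_edge : forall x y, e x y -> dep x != dep y.

(** An edge is represented by the ordered pair of its deeper and its upper end, so that it can be
    attributed to the piece of either end. *)
Definition up : {set T * T} := [set q | e q.1 q.2 & dep q.2 < dep q.1].

Definition uncut (lab : T -> bool) : {set T * T} :=
  [set q in up | lab q.1 == lab q.2].

Lemma up_pair_inj : {in up &, injective (fun q : T * T => [set q.1; q.2])}.
Proof.
move=> [a b] [c d]; rewrite !inE /= => /andP[_ ab] /andP[_ cd] /setP H.
have Hm z : (z == a) || (z == b) = (z == c) || (z == d) by have := H z; rewrite !inE.
have := Hm a; rewrite eqxx /= => /esym/orP[/eqP ac|/eqP ad].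
- have /esym := Hm b; rewrite eqxx orbT => /orP[/eqP bc|/eqP -> //].
  + by move: ab; rewrite bc ac ltnn.
  + by rewrite ac.
- have := Hm c; rewrite eqxx /= => /orP[/eqP ca|/eqP cb].
    by move: cd; rewrite ca ad ltnn.
  by move: ab cd; rewrite cb ad => h1 h2; have := ltn_trans h1 h2; rewrite ltnn.
Qed.

Lemma card_cut (A : {set T}) :
  #|cut e A (~: A)| = #|[set q in up | (q.1 \in A) != (q.2 \in A)]|.
Proof.
rewrite -(card_in_imset (f := fun q : T * T => [set q.1; q.2])); last first.
  by move=> q q' /setIdP[h _] /setIdP[h' _]; apply: up_pair_inj.
congr #|pred_of_set _|; apply/setP => E; apply/imsetP/imsetP => -[[x y]].
  rewrite inE /= => /and3P[exy xA]; rewrite inE => yA ->.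
  have := dep_edge exy; rewrite neq_ltn => /orP[] d.
    exists (y, x); last by rewrite /= setUC.
    by rewrite !inE /= e_sym exy d xA (negPf yA).
  by exists (x, y) => //; rewrite !inE /= exy d xA (negPf yA).
rewrite !inE /= => /andP[/andP[exy d] xy] ->.
case: (boolP (x \in A)) xy => [xA /= yA | xA].
  by exists (x, y) => //; rewrite !inE /= exy xA yA.
rewrite eq_sym eqbF_neg negbK => yA.
by exists (y, x); rewrite /= 1?setUC // !inE /= e_sym exy xA yA.
Qed.

Lemma card_edges : #|edges e| = #|up|.
Proof.
rewrite -(card_in_imset up_pair_inj).
congr #|pred_of_set _|; apply/setP => E; apply/imsetP/imsetP => -[[x y]].
  rewrite inE /= => exy ->.
  have := dep_edge exy; rewrite neq_ltn => /orP[] d.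
    by exists (y, x); rewrite /= 1?setUC // !inE /= e_sym exy d.
  by exists (x, y) => //; rewrite !inE /= exy d.
by rewrite !inE /= => /andP[exy d] ->; exists (x, y); rewrite // inE.
Qed.

Lemma cut_uncut (A : {set T}) :
  #|cut e A (~: A)| + #|uncut (fun v => v \in A)| = #|edges e|.
Proof.
rewrite card_cut card_edges -(cardsID [set q | (q.1 \in A) == (q.2 \in A)] up).
rewrite addnC; congr (_ + _); apply: eq_card => q; rewrite !inE //.
by rewrite andbC.
Qed.

Lemma eq_uncut lab lab' : lab =1 lab' -> uncut lab = uncut lab'.
Proof. by move=> h; apply/setP => q; rewrite !inE !h. Qed.

(** Adjacency lists show every edge from both ends; this turns counts made by the program into
    counts of [up] pairs. *)
Lemma up_pairs (f : rel T) : symmetric f ->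
  \sum_(x : T) #|[set y | e x y & f x y]| = (#|[set q in up | f q.1 q.2]|).*2.
Proof.
move=> fs.
have -> : \sum_(x : T) #|[set y | e x y & f x y]|
   = #|[set q : T * T | e q.1 q.2 & f q.1 q.2]|.
  rewrite -sum1_card (eq_bigl (fun q : T * T => true && (e q.1 q.2 && f q.1 q.2))); last first.
    by move=> q; rewrite inE.
  rewrite -(pair_big_dep xpredT (fun x y => e x y && f x y) (fun _ _ => 1)) /=.
  by apply: eq_bigr => x _; rewrite -sum1_card; apply: eq_bigl => y; rewrite inE.
rewrite -(cardsID up [set q : T * T | e q.1 q.2 & f q.1 q.2]) -addnn; congr (_ + _).
  by apply: eq_card => q; rewrite !inE; do 2?case: (_ q.1 q.2) => /=; rewrite ?andbF ?andbT.
have sw : injective (fun q : T * T => (q.2, q.1)) by move=> [a b] [c d] [-> ->].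
rewrite -[RHS](card_imset _ sw); apply: eq_card => -[x y].
rewrite !inE /=; apply/idP/imsetP.
  move=> /andP[d /andP[exy fxy]]; exists (y, x) => //.
  rewrite !inE /= e_sym exy fs fxy andbT /=.
  by have := dep_edge exy; move: d; rewrite exy /=; lia.
move=> [[a b]]; rewrite !inE /= => /andP[/andP[eab d] fab] [-> ->].
by rewrite e_sym eab fs fab /= -leqNgt ltnW.
Qed.

End UpEdges.

(** * Pieces of the severed tree, and the odd cycles that they force *)

Section Tree.

Variables (T : finType) (e : rel T) (r : T) (p : T -> T) (dep : T -> nat).
Hypothesis tree : dfs_tree e r p dep.
Hypotheses (e_sym : symmetric e) (e_irr : irreflexive e).

Lemma tree_ind (P : T -> Prop) :
  (forall v, (v != r -> P (p v)) -> P v) -> forall v, P v.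
Proof.
move=> H v; have [k] := ubnP (dep v); elim: k v => // k IH v vk.
by apply: H => vr; apply: IH; rewrite -ltnS -(dep_parent tree vr).
Qed.

Lemma anc_refl v : anc p v v.
Proof. exact: connect0. Qed.

Lemma anc_trans b a c : anc p a b -> anc p b c -> anc p a c.
Proof. by move=> ab bc; apply: connect_trans bc ab. Qed.

Lemma anc_parent v : anc p (p v) v.
Proof. exact: fconnect1. Qed.

Lemma ancP a b : reflect (a = b \/ b != r /\ anc p a (p b)) (anc p a b).
Proof.
apply: (iffP idP) => [|[->|[_ /anc_trans]]]; last 2 first.
- exact: anc_refl.
- by apply; apply: anc_parent.
move=> ab; case: (eqVneq a b) => [|nab]; [by left | right].
have h : anc p a (p b).
  move: ab => /iter_findex; case: (findex _ _ _) => [/= eab|k]; first by rewrite eab eqxx in nab.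
  by rewrite iterSr => <-; apply: fconnect_iter.
split=> //; apply/eqP => br; case/eqP: nab; move: ab; rewrite br.
move=> /iter_findex <-; elim: (findex _ _ _) => //= k ->.
by rewrite (tree_root tree).
Qed.

Lemma dep_gt0 v : 0 < dep v.
Proof.
have [->|/(dep_parent tree) ->] := eqVneq v r; by rewrite ?(dep_root tree).
Qed.

Lemma anc_dep a b : anc p a b -> dep a <= dep b ?= iff (a == b).
Proof.
elim/tree_ind: b => b IH; case/ancP => [->|[br ab]].
  by rewrite eqxx; split; rewrite ?eqxx.
have lt : dep a < dep b by rewrite (dep_parent tree br) ltnS IH.
split; first exact: ltnW.
by rewrite ltn_eqF //; apply/esym; apply: contraTF lt => /eqP ->; rewrite ltnn.
Qed.

Lemma anc_linear a b x : anc p a x -> anc p b x -> dep a <= dep b -> anc p a b.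
Proof.
elim/tree_ind: x => x IH ax; case/ancP => [->//|[xr bx]] ab.
case/ancP: ax => [ax|[_ ax]]; last exact: IH.
have /= := anc_dep bx => -[]; rewrite leqNgt -ltnS -(dep_parent tree xr) ltnS.
by rewrite -ax; lia.
Qed.

Lemma anc_dep_inj a b x : anc p a x -> anc p b x -> dep a = dep b -> a = b.
Proof.
move=> ax bx ab; have := anc_linear ax bx; rewrite ab leqnn => /(_ isT) /anc_dep [_].
by rewrite ab eqxx => /esym/eqP.
Qed.

Lemma dep_edge x y : e x y -> dep x != dep y.
Proof.
move=> exy; have xy : x != y by apply: contraTneq exy => ->; rewrite e_irr.
case/orP: (edge_anc tree exy) => /anc_dep[_]; first by rewrite (negPf xy) => ->.
by rewrite eq_sym [y == x]eq_sym (negPf xy) => ->.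
Qed.

Lemma up_anc x y : (x, y) \in up e dep -> anc p y x.
Proof.
rewrite inE /= => /andP[exy d]; case/orP: (edge_anc tree exy) => // /anc_dep [].
by rewrite leqNgt d.
Qed.

Lemma up_parent v : v != r -> (v, p v) \in up e dep.
Proof. by move=> vr; rewrite inE /= (tree_edge tree vr) (dep_parent tree vr) leqnn. Qed.

Definition bad (x y : T) : bool :=
  ((x, y) \in up e dep) && (odd (dep x) == odd (dep y)).

Definition good (x y : T) : bool :=
  [&& (x, y) \in up e dep, odd (dep x) != odd (dep y) & y != p x].

(* [hang z a]: [z] belongs to the subtree still hanging at [a] when [a] is
   reached on the way up.  [req a] is the largest depth of the upper end of a bad
   edge from this subtree, and [g a] tells whether it has a good non-tree edge. *)
Variables (req : T -> nat) (g : T -> bool).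

(** For [v != r], [req_lt] makes [dep (p v)] the largest possible value of [req v], so equality
    detects a bad edge from the hanging subtree to the parent. The root is never severed, since
    [req r = 0]. *)
Definition severed (v : T) : bool := req v == dep (p v).

Definition hang (z a : T) : bool :=
  connect (fun u v => ~~ severed u && (p u == v)) z a.

Hypothesis req_lt : forall v, req v < dep v.
Hypothesis req_ge : forall z a y, hang z a -> bad z y -> dep y <= req a.
Hypothesis req_attained : forall a, 0 < req a ->
  exists z y, [/\ hang z a, bad z y & dep y = req a].

Hypothesis gP : forall a,
  g a <-> exists z y, hang z a /\ good z y.

Variable pc : T -> T.
Hypothesis pcE : forall v, pc v = if severed v then v else pc (p v).
Hypothesis pc_root : pc r = r.

Lemma severed_root : severed r = false.
Proof.
rewrite /severed (tree_root tree) (dep_root tree).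
by have := req_lt r; rewrite (dep_root tree); case: (req r).
Qed.

Lemma severed_neq v : severed v -> v != r.
Proof. by apply: contraTneq => ->; rewrite severed_root. Qed.

Lemma hang_step z a : hang z a -> z = a \/ ~~ severed z /\ hang (p z) a.
Proof.
case/connectP => -[|u s] /=; first by move=> _ ->; left.
move=> /andP[/andP[zn /eqP pz] hs] ha; right; split=> //; rewrite pz.
by apply/connectP; exists s.
Qed.

Lemma hang_refl z : hang z z.
Proof. exact: connect0. Qed.

Lemma hang_parent z a : ~~ severed z -> hang (p z) a -> hang z a.
Proof. by move=> zn; apply: connect_trans; apply: connect1; rewrite zn eqxx. Qed.

Lemma hang_anc z a : hang z a -> anc p a z.
Proof.
elim/tree_ind: z => z IH /hang_step[->|[zn h]]; first exact: anc_refl.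
have [zr|zr] := eqVneq z r; last exact: anc_trans (IH zr h) (anc_parent z).
move: h; rewrite zr (tree_root tree) => /connectP[s]; elim: s => [|u s IHs] /=.
  by move=> _ ->; apply: anc_refl.
by move=> /andP[/andP[_ /eqP <-]]; rewrite (tree_root tree).
Qed.

Lemma hang_pc z a : hang z a -> pc z = pc a.
Proof.
elim/tree_ind: z => z IH /hang_step[->//|[zn h]].
have [zr|zr] := eqVneq z r; last by rewrite pcE (negPf zn) IH.
move: h; rewrite zr (tree_root tree) => /connectP[s]; elim: s => [|u s IHs] /=.
  by move=> _ ->.
by move=> /andP[/andP[_ /eqP <-]]; rewrite (tree_root tree).
Qed.

Lemma pc_hang v : hang v (pc v).
Proof.
elim/tree_ind: v => v IH; rewrite pcE; case: ifP => sv; first exact: hang_refl.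
have [vr|vr] := eqVneq v r; last by apply: hang_parent (IH vr); rewrite sv.
by rewrite vr (tree_root tree) pc_root hang_refl.
Qed.

Lemma pc_severed v : severed (pc v) = (pc v != r).
Proof.
elim/tree_ind: v => v IH; rewrite pcE; case: ifP => sv.
  by rewrite sv severed_neq.
have [->|vr] := eqVneq v r; last exact: IH.
by rewrite (tree_root tree) pc_root severed_root eqxx.
Qed.

Lemma pc_of_severed v : severed v -> pc v = v.
Proof. by move=> sv; rewrite pcE sv. Qed.

Lemma anc_hang x y : anc p y x -> anc p (pc x) y -> hang x y.
Proof.
elim/tree_ind: x => x IH yx; rewrite pcE; case: ifP => sx.
  move=> xy; have -> : y = x; last exact: hang_refl.
  by apply: (anc_dep_inj yx (anc_refl x)); apply/eqP; rewrite eqn_leq (anc_dep yx) (anc_dep xy).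
case/ancP: yx => [->|[xr yx]] h; first exact: hang_refl.
by apply: hang_parent; rewrite ?sx //; apply: IH.
Qed.

(** The ancestors of [x] form a chain through [pc x]: those not above [pc x] hang at it, the others
    lie above its parent. *)
Lemma anc_pc x y : anc p y x ->
  pc y = pc x \/ severed (pc x) /\ anc p y (p (pc x)).
Proof.
move=> yx; have px := hang_anc (pc_hang x).
case: (leqP (dep (pc x)) (dep y)) => d.
  by left; apply/esym/hang_pc/anc_hang => //; apply: (anc_linear px yx d).
right; have /ancP[yp|[pr yp]] := anc_linear yx px (ltnW d).
  by rewrite yp ltnn in d.
by rewrite pc_severed pr.
Qed.

Lemma bad_anc z y : bad z y -> anc p y z.
Proof. by case/andP => /up_anc. Qed.

(** Inside one piece, [x] would hang at [y], and the bad edge would give [dep y <= req y], against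
    [req_lt]. *)
Lemma piece_bip x y : bad x y -> pc x != pc y.
Proof.
move=> bxy; apply/eqP => pxy; have yx := bad_anc bxy.
have /andP[uxy _] := bxy; have d : dep y < dep x by move: uxy; rewrite inE => /andP[].
have hxy : hang x y by apply: anc_hang => //; rewrite pxy (hang_anc (pc_hang y)).
have : dep y <= req y by apply: req_ge hxy bxy.
by rewrite leqNgt req_lt.
Qed.

(** The cycle is made of the tree path from some [z] of the piece up to [p c] and of a bad edge from
    [z] to [p c]. All its edges have their lower end in the piece of [c], which makes the cycles of
    different [c] edge-disjoint. *)
Lemma odd_cycle (s : T -> bool) c : severed c ->
  exists w y, (w, y) \in uncut e dep s /\ pc w = c.
Proof.
move=> sc; case: (boolP [exists q, (q \in uncut e dep s) && (pc q.1 == c)]).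
  by case/existsP => -[w y] /andP[u /eqP ?]; exists w, y.
rewrite negb_exists => /forallP N.
have {}N w y : (w, y) \in up e dep -> pc w = c -> s w = ~~ s y.
  move=> uwy pw; have := N (w, y); rewrite inE uwy /= pw eqxx andbT.
  by case: (s w); case: (s y).
have cr := severed_neq sc.
(* If all edges starting in the piece are cut, [s] alternates along the tree as far as [p c], hence
   follows the depth parity up to a constant; the bad edge contradicts this. *)
have al v : pc v = c -> s v (+) odd (dep v) = s (p c) (+) odd (dep (p c)).
  elim/tree_ind: v => v IH pv; have vr : v != r.
    by apply: contraNneq cr => vr; rewrite -pv vr pc_root.
  rewrite (N _ _ (up_parent vr) pv) (dep_parent tree vr) /= addbN addNb negbK.
  by move: pv; rewrite pcE; case: ifP => _; [move=> -> | apply: IH].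
have req0 : 0 < req c by rewrite (eqP sc) dep_gt0.
have [z [y [hz bz dy]]] := req_attained req0.
have pz : pc z = c by rewrite (hang_pc hz) pc_of_severed.
have yE : y = p c.
  apply: (anc_dep_inj (bad_anc bz)); last by rewrite dy; apply/eqP.
  exact: anc_trans (anc_parent c) (hang_anc hz).
move: bz (al z pz); rewrite yE => /andP[u /eqP ->].
by rewrite (N _ _ u pz); case: (s _); case: (odd _).
Qed.

Lemma severed_uncut (s : T -> bool) :
  #|[set c | severed c]| <= #|uncut e dep s|.
Proof.
apply: leq_trans (leq_imset_card (fun q => pc q.1) _).
apply/subset_leq_card/subsetP => c; rewrite inE => /(odd_cycle s)[w [y [u <-]]].
by apply/imsetP; exists (w, y).
Qed.

Definition cross : {set T * T} := [set q in up e dep | pc q.1 != pc q.2].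

(** By [piece_bip] these edges have ends of different parity. They are counted apart because one of
    them is all the slack wanted when [q = k = 1]. *)
Definition inner : {set T * T} :=
  [set q in up e dep | (pc q.1 == pc q.2) && (q.2 != p q.1)].

(** A crossing edge is charged to the piece of its upper end. With [b] true these are the edges
    missed when piece [c] keeps its depth parity, with [b] false those cut; turning [c] over
    exchanges the two. *)
Definition piece_tally (flip : T -> bool) (c : T) (b : bool) : nat :=
  \sum_(y | pc y == c) #|[set x | e y x & [&& dep y < dep x, pc x != pc y &
     (odd (dep y) == odd (dep x) (+) flip (pc x)) == b]]|.

Lemma sum_pieces (F : T -> T -> nat) :
  \sum_c \sum_(y | pc y == c) F c y = \sum_y F (pc y) y.
Proof.
rewrite [RHS](partition_big pc xpredT) //=.
by apply: eq_bigr => c _; apply: eq_bigr => y /eqP ->.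
Qed.

Lemma card_pairs (Q : rel T) :
  \sum_y #|[set x | Q x y]| = #|[set q | Q q.1 q.2]|.
Proof.
rewrite -[RHS]sum1_card (eq_bigl (fun q : T * T => true && Q q.1 q.2)); last first.
  by move=> q; rewrite inE.
rewrite -(pair_big_dep xpredT Q (fun _ _ => 1)) /= (exchange_big_dep xpredT) //=.
by apply: eq_bigr => y _; rewrite -sum1_card; apply: eq_bigl => x; rewrite inE.
Qed.

(** * The majority labelling *)

Section Majority.

Variable flip : T -> bool.
(** There is no circularity: by [anc_pc], the tally of [c] reads [flip] only at roots of pieces
    lying below [c]. *)
Hypothesis flipE : forall c, flip c = (piece_tally flip c false < piece_tally flip c true).

Definition majority_label (v : T) : bool := odd (dep v) (+) flip (pc v).

Lemma uncut_majority_cross :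
  uncut e dep majority_label \subset cross.
Proof.
apply/subsetP => -[x y]; rewrite !inE /= => /andP[uxy l]; rewrite uxy /=.
apply/eqP => pxy; move: l; rewrite /majority_label pxy (inj_eq (@addIb _)) => o.
have /piece_bip : bad x y by rewrite /bad inE uxy.
by rewrite pxy eqxx.
Qed.

(** Every crossing edge belongs to exactly one tally, and after the majority vote the missed edges
    of a piece are the smaller of its two tallies. *)
Lemma uncut_majority : #|uncut e dep majority_label| * 2 <= #|cross|.
Proof.
have -> : #|uncut e dep majority_label| = \sum_c piece_tally flip c (~~ flip c).
  rewrite sum_pieces card_pairs; apply: eq_card => -[x y].
  have := subsetP uncut_majority_cross (x, y).
  rewrite !inE /= [e y x]e_sym /majority_label.
  case: (e x y); case: (dep y < dep x); rewrite ?andbF //= => sub.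
  apply/idP/andP => [l|[_]]; first split; first exact: sub.
    by move: l; case: (odd _); case: (odd _); case: (flip _); case: (flip _).
  by case: (odd _); case: (odd _); case: (flip _); case: (flip _).
have -> : #|cross| = \sum_c (piece_tally flip c true + piece_tally flip c false).
  transitivity (\sum_y #|[set x | (x, y) \in cross]|).
    by rewrite (card_pairs (fun x y => (x, y) \in cross)); apply: eq_card => -[x y]; rewrite [in RHS]inE.
  rewrite big_split !sum_pieces -big_split /=; apply: eq_bigr => y _.
  rewrite -(cardsID [set x | (odd (dep y) == odd (dep x) (+) flip (pc x))]).
  by congr (_ + _); apply: eq_card => x; rewrite !inE /= [e y x]e_sym; case: (_ == _ (+) _);
    rewrite ?andbF ?andbT ?andbA.
rewrite big_distrl; apply: leq_sum => c _ /=.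
have := flipE c; case: (flip c) => /=; lia.
Qed.

(** The [n - 1 - q] unsevered tree edges and the [inner] edges all lie inside pieces; the crossing
    edges are at most the rest, and at most half of them are missed. *)
Lemma majority_bound :
  #|uncut e dep majority_label| * 2 + #|inner| + #|T|
    <= #|up e dep| + 1 + #|[set c | severed c]|.
Proof.
have := uncut_majority.
pose tr := [set v | (v != r) && ~~ severed v].
have trE : #|tr| + 1 + #|[set c | severed c]| = #|T|.
  rewrite -(cardsC [set c | severed c]) addnC (cardsD1 r (~: _)) !inE severed_root /=.
  by rewrite [1 + _]addnC; congr (_ + (_ + _)); apply: eq_card => v; rewrite !inE.
pose same := [set q in up e dep | pc q.1 == pc q.2].
have sameE : #|cross| + #|same| = #|up e dep|.
  rewrite addnC -[RHS](cardsID [set q | pc q.1 == pc q.2]).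
  by congr (_ + _); apply: eq_card => q; rewrite !inE // andbC.
have sameE2 : #|inner| + #|tr| <= #|same|.
  rewrite -(cardsID [set q | q.2 != p q.1] same) leq_add //.
    by apply/subset_leq_card/subsetP => q; rewrite !inE andbA.
  rewrite -(card_imset (f := fun v => (v, p v))) => [|u v [//]].
  apply/subset_leq_card/subsetP => q /imsetP[v]; rewrite inE => /andP[vr sv] ->.
  by rewrite inE [in X in _ && X]inE up_parent //= !inE negbK eqxx [pc v]pcE (negPf sv) /=.
lia.
Qed.

Lemma uncut_majority0 : #|[set c | severed c]| = 0 ->
  #|uncut e dep majority_label| = 0.
Proof.
move/eqP; rewrite cards_eq0 => /eqP q0; have pr v : pc v = r.
  apply/eqP; rewrite -[_ == _]negbK -pc_severed; apply/negP => sv.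
  by have : pc v \in [set c | severed c]; [rewrite inE | rewrite q0 inE].
apply/eqP; rewrite cards_eq0 -subset0; apply: subset_trans uncut_majority_cross _.
by apply/subsetP => q; rewrite !inE !pr eqxx andbF.
Qed.

(** * The labelling that switches branches *)

Variable F : T -> bool.
Hypothesis FE : forall v,
  F v = ~~ g v && (0 < req v) || ~~ severed v && F (p v).
Hypothesis F_root : F r = false.

Definition branch_label (v : T) : bool := odd (dep v) (+) F v.

Lemma F_hang v : F v -> exists a, [/\ hang v a, ~~ g a & 0 < req a].
Proof.
elim/tree_ind: v => v IH; rewrite FE => /orP[/andP[ga ra]|/andP[sv Fp]].
  by exists v; rewrite hang_refl.
have [vr|vr] := eqVneq v r; first by rewrite vr (tree_root tree) F_root in Fp.
by have [a [h ga ra]] := IH vr Fp; exists a; split=> //; apply: hang_parent.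
Qed.

Lemma hang_F v a : hang v a -> F a -> F v.
Proof.
elim/tree_ind: v => v IH /hang_step[-> //|[sv h] Fa].
have [vr|vr] := eqVneq v r; last by rewrite FE sv IH ?orbT.
have : anc p a r by move: (hang_anc h); rewrite vr (tree_root tree).
by case/ancP => [ar|[]]; [rewrite ar F_root in Fa | rewrite eqxx].
Qed.

Lemma branch_label_good x y : good x y -> F x = F y -> branch_label x != branch_label y.
Proof.
by move=> /and3P[_ o _] Fxy; rewrite /branch_label Fxy (inj_eq (@addIb _)).
Qed.

(** * The exceptional case: one severed vertex, pieces that are induced trees, one missed edge *)

Section OneOddCycle.

Variable c : T.
Hypothesis one : forall v, severed v = (v == c).
Hypothesis flat : inner = set0.

Variable s : T -> bool.
Hypothesis s1 : #|uncut e dep s| = 1.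

Lemma pc_one v : (pc v == c) = anc p c v.
Proof.
apply/eqP/idP => [<-|]; first exact: hang_anc (pc_hang v).
case/anc_pc => [<-|[]]; first by rewrite pc_of_severed ?one.
rewrite one => /eqP -> h; have /severed_neq cr : severed c by rewrite one.
have := anc_dep h; rewrite (dep_parent tree cr) => -[]; lia.
Qed.

(** A switched branch has a bad edge, which must leave its piece upwards; only the piece of [c] has
    another piece above it. *)
Lemma F_pc v : F v -> pc v = c.
Proof.
case/F_hang => a [h _ ra]; have [z [y [hz bz _]]] := req_attained ra.
have := piece_bip bz; rewrite (hang_pc h) -(hang_pc hz).
case: (anc_pc (bad_anc bz)) => [->|[]]; first by rewrite eqxx.
by rewrite one => /eqP.
Qed.

Lemma bad_F z y : bad z y -> F y = false.
Proof.
move=> bz; apply/negP => /F_pc py; have := piece_bip bz.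
have /eqP -> : pc z == c by rewrite pc_one (anc_trans _ (bad_anc bz)) // -pc_one py.
by rewrite py eqxx.
Qed.

(** The end [z] is unswitched, since its branch would own a good edge. If [y] were switched, [y] and
    its descendant [z] would both lie in the piece of [c], and the edge would be [inner]. *)
Lemma good_F z y : good z y -> F z = F y.
Proof.
move=> gz; have /and3P[uzy _ yp] := gz; have yz := up_anc uzy.
have -> : F z = false.
  by apply/negP => /F_hang[a [h /negP ga _]]; apply/ga/gP; exists z, y.
apply/esym/negP => Fy; have py := F_pc Fy.
have : (z, y) \in inner; last by rewrite flat inE.
rewrite inE uzy yp py andbT /= pc_one.
by rewrite (anc_trans _ yz) // -pc_one py.
Qed.

(** Good non-tree edges are cut by [good_F], and bad edges with a switched lower end by [bad_F].
    This leaves the unswitched bad edges and the tree edge above the top of each switched branch. *)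
Lemma uncut_branch x y : (x, y) \in uncut e dep branch_label ->
  (y = p x /\ [/\ F x, ~~ F y, ~~ g x & 0 < req x]) \/ bad x y /\ ~~ F x.
Proof.
rewrite inE => /andP[uxy /= l]; have [o|o] := boolP (odd (dep x) == odd (dep y)).
  right; have bxy : bad x y by rewrite /bad uxy.
  split=> //; move: l; rewrite /branch_label (eqP o) (bad_F bxy) addbF.
  by case: (F x); case: (odd _).
left; have yp : y = p x.
  apply/eqP; apply: contraTT l => yp; have gxy : good x y by rewrite /good uxy o.
  exact: branch_label_good (good_F gxy).
have nF : F x != F y.
  by move: l o; rewrite /branch_label; case: (F x); case: (F y); case: (odd _); case: (odd _).
subst y; have nFp : ~~ F (p x).
  apply/negP => Fp; have [sx|sx] := boolP (severed x).
    have /severed_neq cr : severed c by rewrite one.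
    move: Fp sx => /F_pc pcx; rewrite one => /eqP xc; subst x.
    move/eqP: pcx; rewrite pc_one => /anc_dep[].
    by rewrite (dep_parent tree cr) ltnn.
  by move: nF; rewrite FE sx Fp orbT.
have Fx : F x by move: nF nFp; case: (F x); case: (F (p x)).
have /andP[] : ~~ g x && (0 < req x) by move: Fx; rewrite FE (negPf nFp) andbF orbF.
by [].
Qed.

Lemma uncut_branch_le1 : #|uncut e dep branch_label| <= 1.
Proof.
have sc : severed c by rewrite one.
have [w [y [uwy pw]]] := odd_cycle s sc.
have sE q : (q \in uncut e dep s) = (q == (w, y)).
  have /cards1P[q0 E] : #|uncut e dep s| == 1 by rewrite s1.
  by move: uwy; rewrite E !inE => /eqP ->.
have wr : w != r.
  by apply: contraTneq (severed_neq sc) => wr; rewrite -pw wr pc_root eqxx.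
have up_s x z : (x, z) \in up e dep -> (x, z) != (w, y) -> s x = ~~ s z.
  move=> u; rewrite -sE inE u /=; by case: (s x); case: (s z).
(* [sg] compares [s] with the depth parity. Across a cut edge it changes exactly when the edge is
   bad, so along the tree it can change only at [(w, y)]. *)
pose sg v := s v (+) odd (dep v).
have sg_tree v : v != r -> v != w -> sg v = sg (p v).
  move=> vr vw; rewrite /sg (up_s _ _ (up_parent vr)); last by rewrite xpair_eqE (negPf vw).
  by rewrite (dep_parent tree vr) /= addbN addNb negbK.
have hang_w z : anc p w z -> hang z w.
  move=> wz; apply: anc_hang => //.
  have /eqP -> : pc z == c by rewrite pc_one (anc_trans _ wz) // -pc_one pw.
  by rewrite -pc_one pw.
have bad_ne z b : bad z b -> y = p w -> (z, b) != (w, y).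
  move=> /andP[_ o] yp; apply/eqP => -[zw byE]; move: o.
  by rewrite zw byE yp (dep_parent tree wr) /=; case: (odd _).
(* All the roots of the switched branches being comparable, there is only one. *)
have comparable x0 : (forall u, F u -> ~~ F (p u) -> 0 < req u -> anc p u x0) ->
    (forall z b, bad z b -> F z) -> #|uncut e dep branch_label| <= 1.
  move=> top bF; have topE u v : F u -> ~~ F (p u) -> 0 < req u ->
      F v -> ~~ F (p v) -> 0 < req v -> dep u <= dep v -> u = v.
    move=> Fu nu ru Fv nv rv d.
    have /ancP[//|[vr uv]] := anc_linear (top u Fu nu ru) (top v Fv nv rv) d.
    case/negP: nv; apply: hang_F (Fu); apply: anc_hang => //.
    have /F_pc pu := Fu; have cu : anc p c u by rewrite -pc_one pu.
    have /eqP -> : pc (p v) == c by rewrite pc_one (anc_trans cu uv).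
    exact: cu.
  apply/card_le1_eqP => -[x z] [x' z'].
  move=> /uncut_branch[[zp [Fx nFz _ rx]]|[/bF -> //]].
  move=> /uncut_branch[[zp' [Fx' nFz' _ rx']]|[/bF -> //]].
  subst z z'; suff -> : x = x' by [].
  by case: (leqP (dep x) (dep x')) => [|/ltnW] d; [|apply/esym]; apply: topE d.
(* Either [(w, y)] is a tree edge and [sg] is flipped exactly on the subtree of [w], or [sg] is
   constant and [(w, y)] is the only bad edge. *)
have [yp|yp] := eqVneq y (p w).
  have sgE v : sg v = sg r (+) anc p w v.
    elim/tree_ind: v => v IH; have [->|vr] := eqVneq v r.
      have -> : anc p w r = false; last by rewrite addbF.
      by apply/negP => /ancP[wr'|[]]; [rewrite wr' eqxx in wr | rewrite eqxx].
    have [vw|vw] := eqVneq v w.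
      subst v; rewrite anc_refl addbT.
      have : s w == s y by move: uwy; rewrite inE => /andP[].
      move=> /eqP; rewrite /sg => ->; rewrite (dep_parent tree wr) yp /= addbN; congr (~~ _).
      rewrite -/(sg (p w)) IH //; have -> : anc p w (p w) = false; last by rewrite addbF.
      by apply/negP => /anc_dep[]; rewrite (dep_parent tree wr) ltnn.
    rewrite sg_tree // IH //; congr (_ (+) _); apply/idP/ancP => [h|[wv|[_ h]]] //.
      by right.
    by rewrite wv eqxx in vw.
  have badw z b : bad z b -> anc p w z.
    move=> bz; have /andP[u /eqP o] := bz; have bz' := bad_anc bz.
    have : sg z != sg b by rewrite /sg (up_s _ _ u (bad_ne _ _ bz yp)) o; case: (s b); case: (odd _).
    rewrite (sgE z) (sgE b); have [//|nwz] := boolP (anc p w z).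
    have -> : anc p w b = false; last by rewrite eqxx.
    by apply: contraNF nwz => h; apply: anc_trans h bz'.
  (* A good edge starting below [w] preserves [sg], so it ends below [w] too, hence inside the piece
     of [c]; [flat] excludes this. *)
  have gw : ~~ g w.
    apply/negP => /gP[z [b [hz gz]]]; have /and3P[u o bp] := gz.
    have wz := hang_anc hz; have : sg z = sg b.
      rewrite /sg (up_s _ _ u); last first.
        by apply: contraNneq bp => -[-> ->]; rewrite yp.
      by move: o; case: (s b); case: (odd (dep z)); case: (odd (dep b)).
    rewrite (sgE z) (sgE b) wz => /addbI /esym wb.
    have : (z, b) \in inner; last by rewrite flat inE.
    have cE v : anc p w v -> pc v = c.
      by move=> wv; apply/eqP; rewrite pc_one (anc_trans _ wv) // -pc_one pw.
    by rewrite inE u /= bp !cE ?eqxx.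
  have rw : 0 < req w.
    have rc : 0 < req c by rewrite (eqP sc) dep_gt0.
    have [z [b [_ bz _]]] := req_attained rc.
    exact: leq_trans (dep_gt0 b) (req_ge (hang_w _ (badw _ _ bz)) bz).
  have Fw : F w by rewrite FE gw rw.
  (* A top [u] has a bad edge starting at a common descendant of [u] and [w]. Were [u] strictly
     below [w], its parent would be switched together with [w]. *)
  apply: (comparable w) => [u Fu nu ru|z b /badw wz]; last exact: hang_F (hang_w _ wz) Fw.
  have [z [b [hz bz _]]] := req_attained ru.
  have wz := badw _ _ bz; have uz := hang_anc hz.
  have [|/ltnW d] := leqP (dep u) (dep w); first exact: anc_linear uz wz.
  have /ancP[->|[_ wu]] := anc_linear wz uz d; first exact: anc_refl.
  by case/negP: nu; apply: hang_F (hang_w _ wu) Fw.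
have sgE v : sg v = sg r.
  elim/tree_ind: v => v IH; have [->//|vr] := eqVneq v r.
  rewrite -(IH vr) /sg (up_s _ _ (up_parent vr)); last first.
    by apply: contraNneq yp => -[-> ->].
  by rewrite (dep_parent tree vr) /= addbN addNb negbK.
have badE z b : bad z b -> z = w /\ b = y.
  move=> /andP[u /eqP o]; have [[-> ->]//|ne] := eqVneq (z, b) (w, y).
  have := etrans (sgE z) (esym (sgE b)); rewrite /sg (up_s _ _ u ne) o.
  by case: (s b); case: (odd _).
have topw u : 0 < req u -> hang w u.
  by move=> /req_attained[z [b [hz /badE[<- _] _]]].
(* By [topw], [w] hangs at every vertex with positive [req]. So if [w] is switched, all tops are
   ancestors of [w]; if not, there is no top, and only [(w, y)] can be missed. *)
have [Fw|nFw] := boolP (F w).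
  apply: (comparable w) => [u _ _ /topw /hang_anc //|z b /badE[-> _]//].
apply/card_le1_eqP => -[x z] [x' z'].
have alone x1 z1 : (x1, z1) \in uncut e dep branch_label -> x1 = w /\ z1 = y.
  move=> /uncut_branch[[_ [Fx _ _ /topw hx]]|[/badE //]].
  by case/negP: nFw; apply: hang_F hx Fx.
by move=> /alone[-> ->] /alone[-> ->].
Qed.

End OneOddCycle.

Lemma better_label (s : T -> bool) : #|up e dep| <= 2 * #|T| ->
  let m := #|up e dep| in
  let l := minn #|uncut e dep majority_label| #|uncut e dep branch_label| in
  l = 0 \/ 2 * m * l + m * #|T| <= m * m + #|uncut e dep s| * (m + #|T|).
Proof.
move=> mn m l; set n := #|T|; set k := #|uncut e dep s|.
have := severed_uncut s; have := majority_bound; have := severed_uncut majority_label.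
have := uncut_majority0.
set q := #|[set c | severed c]|; set L1 := #|uncut e dep majority_label| in l *.
rewrite -/m -/n -/k => q0 qL1 bound qk.
have lL1 : l <= L1 by rewrite geq_minl.
have [/q0 L10|qpos] := posnP q; first by left; lia.
have {}mn : m <= 2 * n by [].
have [k2|k1] := leqP 2 k.
  right; have h1 : 2 * l + n <= m + 1 + q by lia.
  have h2 : m <= k * n by apply: leq_trans mn _; rewrite leq_mul2r k2 orbT.
  have h3 : m * q <= m * k by rewrite leq_mul2l qk orbT.
  have := leq_mul (leqnn m) h1; nia.
have [q1 kk] : q = 1 /\ k = 1 by lia.
have [I0|Ipos] := posnP #|inner|; last first.
  (* One [inner] edge cancels the contribution of [q = 1] to [majority_bound]. *)
  right; have h1 : 2 * l + n <= m + 1 by lia.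
  by have := leq_mul (leqnn m) h1; rewrite kk; nia.
have /cards1P[c cE] : #|[set c | severed c]| == 1 by rewrite -/q q1.
have one v : severed v = (v == c) by have := in_set1 v c; rewrite -cE inE.
have flat : inner = set0 by apply/eqP; rewrite -cards_eq0 I0.
have := uncut_branch_le1 one flat kk.
have : l <= #|uncut e dep branch_label| by rewrite geq_minr.
set L2 := #|uncut e dep branch_label| => lL2 L21.
have [l0|l1] : l = 0 \/ l = 1 by lia.
  by left.
(* With [l = k = 1] the claim is [(m - 1)(m - n) >= 0]. Here [n <= m] follows from [majority_bound],
   because the majority labelling also misses at least one edge. *)
right; rewrite l1 kk; have nm : n <= m by lia.
have n1 : 0 < n by apply/card_gt0P; exists c.
nia.
Qed.

End Majority.

End Tree.

(** The optimum is [m - k] and the output [m - l]. For [l = 0] the bound 1 in the minimum is used;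
    otherwise clearing denominators gives the integer inequality. *)
Lemma ratio_bound (m n k l : nat) :
  0 < m -> k <= m -> l <= m ->
  l = 0 \/ 2 * m * l + m * n <= m * m + k * (m + n) ->
  (Num.min 1 (1 / 2%:R + n%:R / (2%:R * m%:R)) * (m - k)%:R <= (m - l)%:R :> rat)%R.
Proof.
move=> m0 km lm; set x := (1 / _ + _)%R; have m0' : (0 < m%:R :> rat)%R by rewrite ltr0n.
case=> [->|H].
  apply: (@le_trans _ _ (1 * (m - k)%:R)%R).
    by apply: ler_wpM2r; rewrite ?ler0n // ge_min lexx.
  by rewrite mul1r ler_nat subn0 leq_subr.
apply: (@le_trans _ _ (x * (m - k)%:R)%R).
  by apply: ler_wpM2r; rewrite ?ler0n // ge_min lexx orbT.
have -> : x = ((m + n)%:R / (2 * m)%:R)%R.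
  by rewrite /x natrD natrM; field; rewrite gt_eqF.
rewrite mulrAC ler_pdivrMr; last by rewrite ltr0n; lia.
rewrite -!natrM ler_nat; nia.
Qed.

(** * Program verification *)

(** Total correctness: a halting run is asserted, and its running time is bounded through [Q]. *)
Definition wp (c : com) (s : state) (Q : state -> nat -> Prop) : Prop :=
  exists s' t, exec c s s' t /\ Q s' t.

Lemma wp_mono c s (Q Q' : state -> nat -> Prop) :
  (forall s' t, Q s' t -> Q' s' t) -> wp c s Q -> wp c s Q'.
Proof. by move=> QQ' [s' [t [ex /QQ' h]]]; exists s', t. Qed.

(* Symbolic execution of the loop-free part of a program. *)
Fixpoint vc (c : com) (s : state) (Q : state -> nat -> Prop) : Prop :=
  match c with
  | Skip => Q s 1
  | Assign x a => Q (set_reg s x (aeval s a)) 1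
  | Store b i a => Q (set_arr s b (aeval s i) (aeval s a)) 1
  | Seq c1 c2 => vc c1 s (fun s1 t1 => vc c2 s1 (fun s2 t2 => Q s2 (t1 + t2)))
  | If b c1 c2 => if beval s b then vc c1 s (fun s' t => Q s' t.+1)
                  else vc c2 s (fun s' t => Q s' t.+1)
  | While b c => wp (While b c) s Q
  end.

Lemma vc_wp c s Q : vc c s Q -> wp c s Q.
Proof.
elim: c s Q => [|x a|b i a|c1 IH1 c2 IH2|b c1 IH1 c2 IH2|b c IH] s Q //=.
- by exists s, 1; split=> //; constructor.
- by exists (set_reg s x (aeval s a)), 1; split=> //; constructor.
- by exists (set_arr s b (aeval s i) (aeval s a)), 1; split=> //; constructor.
- move=> /IH1[s1 [t1 [e1 /IH2[s2 [t2 [e2 q]]]]]].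
  by exists s2, (t1 + t2); split=> //; apply: exec_seq e1 e2.
- case: ifPn => bs; [move=> /IH1 | move=> /IH2] => -[s' [t [ex q]]].
    by exists s', t.+1; split=> //; apply: exec_if_true.
  by exists s', t.+1; split=> //; apply: exec_if_false.
Qed.

Fixpoint wregs (c : com) : seq nat :=
  match c with
  | Assign x _ => [:: x]
  | Seq c1 c2 | If _ c1 c2 => wregs c1 ++ wregs c2
  | While _ c => wregs c
  | _ => [::]
  end.

Fixpoint warrs (c : com) : seq nat :=
  match c with
  | Store b _ _ => [:: b]
  | Seq c1 c2 | If _ c1 c2 => warrs c1 ++ warrs c2
  | While _ c => warrs c
  | _ => [::]
  end.

Definition frame (c : com) (s s' : state) : Prop :=
  (forall x : nat, x \notin wregs c -> reg s' x = reg s x) /\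
  (forall b i : nat, b \notin warrs c -> arr s' b i = arr s b i).

Lemma frame_trans c s2 s1 s3 : frame c s1 s2 -> frame c s2 s3 -> frame c s1 s3.
Proof.
by move=> [r1 a1] [r2 a2]; split=> [x h|b i h]; rewrite ?r2 ?r1 ?a2 ?a1.
Qed.

Lemma frame_sub c c' s s' : {subset wregs c <= wregs c'} ->
  {subset warrs c <= warrs c'} -> frame c s s' -> frame c' s s'.
Proof.
move=> sr sa [r a]; split=> [x h|b i h].
  by apply: r; apply: contra h; apply: sr.
by apply: a; apply: contra h; apply: sa.
Qed.

Lemma exec_frame c s s' t : exec c s s' t -> frame c s s'.
Proof.
elim=> {c s s' t} //.
- by move=> x a s; split=> //= y; rewrite inE => /negPf ->.
- by move=> b i a s; split=> //= c j; rewrite inE => /negPf ->.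
- move=> c1 c2 s1 s2 s3 t1 t2 _ f1 _ f2; apply: (@frame_trans _ s2).
    by apply: frame_sub f1 => z /=; rewrite mem_cat => ->.
  by apply: frame_sub f2 => z /=; rewrite mem_cat orbC => ->.
- move=> b c1 c2 s s' t _ _; apply: frame_sub => z /=;
  by rewrite mem_cat => ->.
- move=> b c1 c2 s s' t _ _; apply: frame_sub => z /=;
  by rewrite mem_cat orbC => ->.
- by move=> b c s1 s2 s3 t1 t2 _ _ f1 _ f2; apply: frame_trans f1 f2.
Qed.

Lemma wp_frame c s Q : wp c s Q -> wp c s (fun s' t => Q s' t /\ frame c s s').
Proof. by move=> [s' [t [ex q]]]; exists s', t; split=> //; split=> //; apply: exec_frame ex. Qed.

Lemma wp_seq c1 c2 s Q :
  wp c1 s (fun s1 t1 => wp c2 s1 (fun s2 t2 => Q s2 (t1 + t2))) -> wp (Seq c1 c2) s Q.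
Proof.
move=> [s1 [t1 [e1 [s2 [t2 [e2 q]]]]]].
by exists s2, (t1 + t2); split=> //; apply: exec_seq e1 e2.
Qed.

Lemma wp_if b c1 c2 s Q :
  (if beval s b then wp c1 s (fun s' t => Q s' t.+1)
   else wp c2 s (fun s' t => Q s' t.+1)) -> wp (If b c1 c2) s Q.
Proof.
case: ifPn => bs [s' [t [ex q]]]; exists s', t.+1; split=> //.
  exact: exec_if_true.
exact: exec_if_false.
Qed.

(** [phi] is both variant and time budget: the strict decrease also pays for the loop test, and the
    final [.+1] is the failing test. *)
Lemma wp_while b c s0 (J : state -> Prop) (phi : state -> nat) :
  (forall s, J s -> frame c s0 s -> beval s b ->
     wp c s (fun s' t => J s' /\ t + phi s' < phi s)) ->
  J s0 ->
  wp (While b c) s0 (fun s' t =>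
    [/\ J s', frame c s0 s', ~~ beval s' b & t <= (phi s0).+1]).
Proof.
move=> step; suff gen k s : phi s < k -> frame c s0 s -> J s ->
    wp (While b c) s (fun s' t =>
      [/\ J s', frame c s0 s', ~~ beval s' b & t <= (phi s).+1]).
  by apply: gen (ltnSn _) _.
elim: k s => // k IH s le_k fs Js.
have [bs|bs] := boolP (beval s b); last first.
  by exists s, 1; split=> //; apply: exec_while_false.
have [s1 [t1 [e1 [J1 lt1]]]] := step s Js fs bs.
have f1 := frame_trans fs (exec_frame e1).
have [|s2 [t2 [e2 [J2 f2 b2 lt2]]]] := IH s1 _ f1 J1; first by lia.
exists s2, (t1 + t2).+1; split; first exact: exec_while_true e1 e2.
by split=> //; lia.
Qed.

Definition for_up (i : nat) (body : com) : com :=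
  Seq (Assign i (Const 0))
      (While (Lt (Reg i) (Reg 0)) (Seq body (Assign i (Succ (Reg i))))).

Definition for_down (i : nat) (body : com) : com :=
  Seq (Assign i (Reg 0))
      (While (Lt (Const 0) (Reg i)) (Seq (Assign i (Pred (Reg i))) body)).

(** Each iteration adds a test and an increment, and the leading 2 is the initial assignment plus
    the last test. The body leaves the counter alone, so the invariant is asked only after the
    increment. *)
Lemma wp_for_up i body s0 n (J : nat -> state -> Prop) (T : nat -> nat) :
  reg s0 0 = n -> i != 0 -> i \notin wregs body -> 0 \notin wregs body ->
  J 0 (set_reg s0 i 0) ->
  (forall k s, k < n -> J k s -> reg s i = k -> frame (for_up i body) s0 s ->
     wp body s (fun s' t => J k.+1 (set_reg s' i k.+1) /\ t <= T k)) ->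
  wp (for_up i body) s0 (fun s' t =>
    [/\ J n s', frame (for_up i body) s0 s' & t <= 2 + \sum_(k < n) (T k + 2)]).
Proof.
move=> rn i0 ib b0 J0 step.
have f0 : frame (for_up i body) s0 (set_reg s0 i 0).
  by split=> //= x; rewrite inE negb_or => /andP[/negPf ->].
have fin s : frame (for_up i body) s0 s -> reg s 0 = n.
  by case=> fr _; rewrite fr //= !inE mem_cat inE eq_sym (negPf i0) (negPf b0).
apply: wp_seq; apply: vc_wp => /=.
pose phi s := \sum_(reg s i <= k < n) (T k + 2).
apply: wp_mono (wp_while (J := fun s => reg s i <= n /\ J (reg s i) s)
  (phi := phi) _ _); last first.
- by rewrite /= eqxx.
- move=> s [le Js] fr /=; rewrite (fin s); last first.
    apply: frame_trans f0 _; apply: frame_sub fr => z //=.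
    by rewrite in_cons => ->; rewrite orbT.
  move=> lt; apply: wp_seq.
  have frs : frame (for_up i body) s0 s.
    apply: frame_trans f0 _; apply: frame_sub fr => z //=.
    by rewrite in_cons => ->; rewrite orbT.
  apply: wp_mono (wp_frame (step _ _ lt Js erefl frs)).
  move=> s' t [[J' t'] [fr' _]]; apply: vc_wp; have ri := fr' i ib.
  rewrite /= eqxx ri; split; first by split.
  by rewrite /phi /= eqxx (big_ltn lt); lia.
- move=> s' t [[le Js] fr nb ub]; have frs : frame (for_up i body) s0 s'.
    apply: frame_trans f0 _; apply: frame_sub fr => z //=.
    by rewrite in_cons => ->; rewrite orbT.
  move: nb; rewrite /= (fin _ frs) -leqNgt => ge.
  have E : reg s' i = n by apply/eqP; rewrite eqn_leq le.
  by rewrite E in Js; split=> //; move: ub; rewrite /phi /= eqxx big_mkord.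
Qed.

Lemma wp_for_down i body s0 n (J : nat -> state -> Prop) (T : nat -> nat) :
  reg s0 0 = n -> i \notin wregs body ->
  J n (set_reg s0 i n) ->
  (forall k s, k < n -> J k.+1 s -> frame (for_down i body) s0 s ->
     wp body (set_reg s i k) (fun s' t => J k s' /\ t <= T k)) ->
  wp (for_down i body) s0 (fun s' t =>
    [/\ J 0 s', frame (for_down i body) s0 s' & t <= 2 + \sum_(k < n) (T k + 2)]).
Proof.
move=> rn ib J0 step.
have f0 : frame (for_down i body) s0 (set_reg s0 i n).
  by split=> //= x; rewrite inE negb_or => /andP[/negPf ->].
have lift s : frame (Seq (Assign i (Pred (Reg i))) body) (set_reg s0 i n) s ->
    frame (for_down i body) s0 s.
  move=> fr; apply: frame_trans f0 _; apply: frame_sub fr => z //=.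
  by rewrite !in_cons => /orP[->|->]; rewrite ?orbT.
apply: wp_seq; apply: vc_wp; rewrite /= rn.
pose phi s := \sum_(0 <= k < reg s i) (T k + 2).
apply: wp_mono (wp_while (J := fun s => reg s i <= n /\ J (reg s i) s)
  (phi := phi) _ _); last first.
- by rewrite /= eqxx.
- move=> s [le Js] /lift fr /= lt; apply: wp_seq; apply: vc_wp => /=.
  case E : (reg s i) lt le Js => [//|k] _ le Js /=.
  apply: wp_mono (wp_frame (step k s le Js fr)) => s' t [[J' t'] [fr' _]].
  have ri := fr' i ib; rewrite /= eqxx in ri.
  by rewrite ri; split; [split=> //; apply: ltnW | rewrite /phi E ri big_nat_recr //=; lia].
- move=> s' t [[le Js] fr nb ub]; have frs := lift _ fr.
  move: nb; rewrite /= -leqNgt leqn0 => /eqP E.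
  by rewrite E in Js; split=> //; move: ub; rewrite /phi /= eqxx big_mkord.
Qed.

Definition for_adj (body : com) : com :=
  Seq (Assign 3 (Read 0 (Reg 2)))
      (While (Lt (Reg 3) (Read 0 (Succ (Reg 2))))
             (Seq (Assign 4 (Read 1 (Reg 3)))
                  (Seq body (Assign 3 (Succ (Reg 3)))))).

Definition holds_graph n (N : 'I_n -> seq 'I_n) (s : state) : Prop :=
  forall v : 'I_n, arr s 0 v.+1 = arr s 0 v + size (N v) /\
    forall k, k < size (N v) -> arr s 1 (arr s 0 v + k) = nth v (N v) k.

Lemma holds_graph_frame c n (N : 'I_n -> seq 'I_n) s s' :
  0 \notin warrs c -> 1 \notin warrs c -> frame c s s' ->
  holds_graph N s -> holds_graph N s'.
Proof.
move=> h0 h1 [_ fa] hg v; rewrite !fa //; have [-> h] := hg v; split=> // k kN.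
by rewrite fa // h.
Qed.

(** The invariant is indexed by the scanned prefix of the list. The 3 extra steps per neighbour are
    the test, the load and the increment. *)
Lemma wp_for_adj body s0 n (N : 'I_n -> seq 'I_n) (x : 'I_n)
    (J : seq 'I_n -> state -> Prop) T :
  holds_graph N s0 -> reg s0 2 = x ->
  2 \notin wregs body -> 3 \notin wregs body ->
  0 \notin warrs body -> 1 \notin warrs body ->
  J [::] (set_reg s0 3 (arr s0 0 x)) ->
  (forall l y l' s, N x = l ++ y :: l' -> J l s -> reg s 2 = x ->
     frame (for_adj body) s0 s ->
     wp body (set_reg s 4 y) (fun s' t =>
       J (rcons l y) (set_reg s' 3 (reg s' 3).+1) /\ t <= T)) ->
  wp (for_adj body) s0 (fun s' t =>
    [/\ J (N x) s', frame (for_adj body) s0 s' & t <= 2 + size (N x) * (T + 3)]).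
Proof.
move=> hg rx b2 b3 a0 a1 J0 step.
have [offS adj] := hg x; set o := arr s0 0 x in offS adj *.
have f0 : frame (for_adj body) s0 (set_reg s0 3 o).
  by split=> //= z; rewrite inE negb_or => /andP[/negPf ->].
have lift s : frame (Seq (Assign 4 (Read 1 (Reg 3))) (Seq body (Assign 3 (Succ (Reg 3)))))
    (set_reg s0 3 o) s -> frame (for_adj body) s0 s.
  move=> fr; apply: frame_trans f0 _; apply: frame_sub fr => z //=.
  by move=> h; rewrite in_cons h orbT.
have r2 s : frame (for_adj body) s0 s -> reg s 2 = x.
  by case=> fr _; rewrite fr //= !inE mem_cat inE (negPf b2).
have a0' s i : frame (for_adj body) s0 s -> arr s 0 i = arr s0 0 i.
  by case=> _ fr; rewrite fr //= cats0.
have a1' s i : frame (for_adj body) s0 s -> arr s 1 i = arr s0 1 i.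
  by case=> _ fr; rewrite fr //= cats0.
apply: wp_seq; apply: vc_wp; rewrite /= rx -/o.
pose phi s := (o + size (N x) - reg s 3) * (T + 3).
apply: wp_mono (wp_while (J := fun s => exists k,
   [/\ reg s 3 = o + k, k <= size (N x) & J (take k (N x)) s]) (phi := phi) _ _); last first.
- by exists 0; rewrite /= addn0 take0.
- move=> s [k [rk le Js]] /lift fr /=; rewrite (r2 s) // !a0' // offS rk ltn_add2l => lt.
  apply: wp_seq; apply: vc_wp; rewrite /= a1' // rk adj //.
  set y := nth x (N x) k; apply: wp_seq.
  have := step (take k (N x)) y (drop k.+1 (N x)) s.
  rewrite -drop_nth // cat_take_drop => /(_ erefl Js (r2 s fr) fr).
  move=> /wp_frame; apply: wp_mono => s' t [[J' t'] [fr' _]].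
  have r3 := fr' 3 b3; rewrite /= rk in r3.
  apply: vc_wp; rewrite /= r3; split.
    by exists k.+1; rewrite /= addnS (take_nth x) //; split=> //; rewrite -r3.
  rewrite /phi /= rk.
  have -> : o + size (N x) - (o + k) = (o + size (N x) - (o + k).+1).+1 by lia.
  by rewrite mulSn; lia.
- move=> s' t [[k [rk le Js]] fr nb ub]; have frs := lift _ fr.
  move: nb; rewrite /= r2 // a0' // offS rk ltn_add2l -leqNgt => ge.
  have E : k = size (N x) by apply/eqP; rewrite eqn_leq le.
  rewrite E take_size in Js; split=> //.
  move: ub; rewrite /phi /=; have -> : o + size (N x) - o = size (N x) by lia.
  by lia.
Qed.

(** * The program *)

(* Registers: 0 holds n, 1 a loop counter, 2 the current vertex, 3 a position in
   the list of its neighbours, 4 the current neighbour, 5 the number of visited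
   vertices, 6 and 7 flags and counters.
   Arrays: 0, 1 and 2 are the input and the output; 3 the scanning positions,
   4 the parents, 5 the depths, 6 their parities, 7 the preorder, 8 and 9 [req]
   and [g], 10 the roots of the pieces, 11 the switched branches, 12 and 13 the
   numbers of good and bad edges of the pieces, 14 the pieces to turn over,
   15 and 16 the two candidates. *)

Section DfsInvariant.

Variables (T : finType) (e : rel T) (r : T) (N : T -> seq T).
Hypotheses (e_sym : symmetric e) (NE : forall v, N v =i e v).

(* [k v] entries of [N v] have been scanned; [0 < dep v] means visited. *)
Record dfs_inv (p : T -> T) (dep : T -> nat) (ord : seq T) (cur : T)
    (k : T -> nat) : Prop := DfsInv {
  inv_uniq : uniq ord;
  inv_ord : forall v, (v \in ord) = (0 < dep v);
  inv_root : p r = r /\ dep r = 1;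
  inv_cur : 0 < dep cur;
  inv_parent : forall v, 0 < dep v -> v != r ->
    [/\ 0 < dep (p v), e v (p v), dep v = (dep (p v)).+1 &
        index (p v) ord < index v ord];
  inv_anc : forall x y, 0 < dep x -> 0 < dep y -> e x y -> anc p x y || anc p y x;
  inv_grey : forall z, 0 < dep z -> anc p z cur \/ forall y, e z y -> 0 < dep y;
  inv_scan : forall z y, 0 < dep z -> y \in take (k z) (N z) -> 0 < dep y;
  inv_fresh : forall v, dep v = 0 -> k v = 0
}.

Lemma anc_cases (p : T -> T) a b : anc p a b -> a = b \/ anc p a (p b).
Proof.
move=> /iter_findex; case: (findex _ _ _) => [/= <-|i]; first by left.
by rewrite iterSr => <-; right; apply: fconnect_iter.
Qed.

Lemma dfs_inv_start (p : T -> T) (dep : T -> nat) : p r = r ->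
  (forall v, dep v = (v == r)) ->
  dfs_inv p dep [:: r] r (fun=> 0).
Proof.
move=> pr dE; have vis v : 0 < dep v -> v = r by rewrite dE; case: eqP.
split=> //.
- by move=> v; rewrite inE dE; case: eqP.
- by rewrite dE eqxx.
- by rewrite dE eqxx.
- by move=> v /vis ->; rewrite eqxx.
- by move=> x y /vis -> /vis ->; rewrite /anc connect0.
- by move=> z /vis ->; left; apply: connect0.
- by move=> z y _; rewrite take0.
Qed.

Section Step.

Variables (p : T -> T) (dep : T -> nat) (ord : seq T) (cur : T) (k : T -> nat).
Hypothesis inv : dfs_inv p dep ord cur k.

Definition scan (k : T -> nat) (cur v : T) := if v == cur then (k v).+1 else k v.

Hypothesis cur_lt : k cur < size (N cur).

Lemma take_scan (y0 : T) : take (scan k cur cur) (N cur) =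
  rcons (take (k cur) (N cur)) (nth y0 (N cur) (k cur)).
Proof. by rewrite /scan eqxx (take_nth y0). Qed.

Lemma dfs_inv_skip y0 : 0 < dep (nth y0 (N cur) (k cur)) ->
  dfs_inv p dep ord cur (scan k cur).
Proof.
move=> vy; case: inv => i1 i2 i3 i4 i5 i6 i7 i8 i9; split=> // [z y vz|v v0]; last first.
  by rewrite /scan; case: eqP v0 => [->|_]; [case: (dep cur) i4 | apply: i9].
have [->|zc] := eqVneq z cur; last by rewrite /scan (negPf zc); apply: i8.
rewrite (take_scan y0) mem_rcons inE => /orP[/eqP -> //|]; exact: i8.
Qed.

(** A visited neighbour of the unvisited [y] falls under the first case of [inv_grey]: it is an
    ancestor of [cur], hence of [y]. So every new edge between visited vertices joins [y] to an
    ancestor. *)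
Lemma dfs_inv_discover y : y = nth y (N cur) (k cur) -> dep y = 0 ->
  dfs_inv (fun v => if v == y then cur else p v)
    (fun v => if v == y then (dep cur).+1 else dep v)
    (rcons ord y) y (scan k cur).
Proof.
move=> yE y0; case: inv => i1 i2 [pr dr] i4 i5 i6 i7 i8 i9.
set p' := fun v => _; set dep' := fun v => _.
have ny v : 0 < dep v -> (v == y) = false.
  by apply: contraTF => /eqP ->; rewrite y0.
have vis' v : 0 < dep v -> 0 < dep' v by move=> vv; rewrite /dep' ny.
have visP v : 0 < dep' v -> v = y \/ 0 < dep v.
  by rewrite /dep'; case: eqP => [|_ vv]; [left | right].
have r_vis : 0 < dep r by rewrite dr.
have p_vis v : 0 < dep v -> 0 < dep (p v).
  move=> vv; have [->|vr] := eqVneq v r; first by rewrite pr.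
  by case: (i5 v vv vr).
(* The parent function changes only at [y], and upward paths from visited vertices never meet
   [y]. *)
have ancE a b : 0 < dep b -> anc p a b -> anc p' a b.
  move=> vb /iter_findex <-; have : 0 < dep (iter (findex p b a) p b) /\
      iter (findex p b a) p b = iter (findex p b a) p' b.
    elim: (findex _ _ _) => //= i [vi <-]; split; first exact: p_vis.
    by rewrite /p' (ny _ vi).
  by case=> _ ->; apply: fconnect_iter.
have ycur : anc p' cur y by apply: connect1; rewrite /= /p' eqxx.
have e_cur : e cur y by have := NE cur y; rewrite {1}yE mem_nth.
have y_nord : y \notin ord by rewrite i2 y0.
have to_y z : 0 < dep z -> e z y -> anc p' z y.
  move=> vz ezy; case: (i7 z vz) => [zc|/(_ y ezy)]; last by rewrite y0.
  by apply: connect_trans ycur _; apply: ancE.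
split.
- by rewrite rcons_uniq y_nord.
- move=> v; rewrite mem_rcons inE i2 /dep'; by case: eqP.
- by rewrite /p' /dep' ny.
- by rewrite /dep' eqxx.
- move=> v /visP[->|vv] vr.
    rewrite /p' /dep' !eqxx (ny _ i4); split=> //; first by rewrite e_sym.
    rewrite -!cats1 !index_cat i2 i4 (negPf y_nord) /= eqxx addn0.
    by rewrite index_mem i2.
  have [vp ep dp ip] := i5 v vv vr.
  rewrite /p' (ny _ vv) /dep' (ny _ vv) (ny _ vp); split=> //.
  by rewrite -!cats1 !index_cat !i2 vv vp.
- move=> x z /visP[->|vx] /visP[->|vz] exz.
  + by rewrite /anc connect0.
  + by rewrite orbC to_y // e_sym.
  + by rewrite to_y.
  + by case/orP: (i6 x z vx vz exz) => /ancE ->; rewrite ?orbT.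
- move=> z /visP[->|vz]; first by left; apply: connect0.
  case: (i7 z vz) => [zc|h]; [left | right].
    by apply: connect_trans ycur _; apply: ancE.
  by move=> x /h /vis'.
- have /negPf yc : y != cur by rewrite eq_sym ny.
  move=> z x /visP[->|vz]; first by rewrite /scan yc i9 ?take0.
  have [->|zc] := eqVneq z cur; last by rewrite /scan (negPf zc) => /(i8 z x vz) /vis'.
  rewrite (take_scan y) mem_rcons inE -yE => /orP[/eqP ->|/(i8 _ _ i4) /vis' //].
  by rewrite /dep' eqxx.
- move=> v; rewrite /dep' /scan; case: (v == y) => // v0.
  by case: eqP v0 => [-> d0|_]; [rewrite d0 in i4 | apply: i9].
Qed.

End Step.

(** The exhausted list of [cur] moves it to the second case of [inv_grey], so it may leave the
    active path. *)
Lemma dfs_inv_retreat p dep ord cur k : dfs_inv p dep ord cur k ->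
  size (N cur) <= k cur -> cur != r -> dfs_inv p dep ord (p cur) k.
Proof.
case=> i1 i2 i3 i4 i5 i6 i7 i8 i9 sz cr; split=> //.
  by case: (i5 cur i4 cr).
move=> z vz; case: (i7 z vz) => [zc|]; last by right.
have [->|zp] := anc_cases zc; last by left.
by right=> y ey; apply: (i8 cur) => //; rewrite take_oversize // NE.
Qed.

(** Only the root is an ancestor of the root, so the visited set is closed under [e]; connectivity
    makes it everything. *)
Lemma dfs_inv_stop p dep ord k : dfs_inv p dep ord r k ->
  size (N r) <= k r -> connected_graph e ->
  dfs_tree e r p dep /\
  [/\ uniq ord, forall v, v \in ord &
      forall v, v != r -> index (p v) ord < index v ord].
Proof.
case=> i1 i2 [pr dr] i4 i5 i6 i7 i8 i9 sz conn.
have closed z y : 0 < dep z -> e z y -> 0 < dep y.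
  move=> vz ezy; case: (i7 z vz) => [zr|]; last exact.
  have zE : z = r by move/iter_findex: zr => <-; elim: (findex _ _ _) => //= i ->.
  by apply: (i8 r) => //; rewrite take_oversize // NE -zE.
have vis v : 0 < dep v.
  have /connectP[s path_s ->] := conn r v.
  elim: s r i4 path_s => //= y s IH x vx /andP[exy]; apply: IH.
  exact: closed exy.
by split; [split | split] => // [v vr|v vr|x y|v|v vr]; rewrite ?i2 //;
  first [by case: (i5 v (vis v) vr) | apply: i6].
Qed.

End DfsInvariant.

Definition agree n (s : state) (b : nat) (f : 'I_n -> nat) : Prop :=
  forall v : 'I_n, arr s b v = f v.

Definition listed n (s : state) (b : nat) (l : seq 'I_n.+1) : Prop :=
  forall i, i < size l -> arr s b i = nth ord0 l i.

Definition dfs_step : com :=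
  If (Lt (Read 3 (Reg 2)) (Read 0 (Succ (Reg 2))))
     (Seq (Assign 4 (Read 1 (Read 3 (Reg 2))))
     (Seq (Store 3 (Reg 2) (Succ (Read 3 (Reg 2))))
          (If (Eq (Read 5 (Reg 4)) (Const 0))
              (Seq (Store 4 (Reg 4) (Reg 2))
              (Seq (Store 5 (Reg 4) (Succ (Read 5 (Reg 2))))
              (Seq (If (Eq (Read 6 (Reg 2)) (Const 0))
                       (Store 6 (Reg 4) (Const 1)) Skip)
              (Seq (Store 7 (Reg 5) (Reg 4))
              (Seq (Assign 5 (Succ (Reg 5)))
                   (Assign 2 (Reg 4)))))))
              Skip)))
     (If (Eq (Reg 2) (Const 0)) (Assign 6 (Const 0)) (Assign 2 (Read 4 (Reg 2)))).

Definition dfs_prog : com :=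
  Seq (for_up 1 (Store 3 (Reg 1) (Read 0 (Reg 1))))
  (Seq (Store 5 (Const 0) (Const 1))
  (Seq (Store 6 (Const 0) (Const 1))
  (Seq (Assign 2 (Const 0))
  (Seq (Assign 5 (Const 1))
  (Seq (Assign 6 (Const 1))
       (While (Lt (Const 0) (Reg 6)) dfs_step)))))).

Lemma sum_drop (I : finType) (f g : I -> nat) x :
  (forall v, v != x -> f v = g v) -> (f x).+1 = g x ->
  (\sum_v f v).+1 = \sum_v g v.
Proof.
move=> fg fx; rewrite (bigD1 x) // [RHS](bigD1 x) //= -fx addSn.
by congr (_ + _).+1; apply: eq_bigr.
Qed.

(** * Correctness and running time of the search *)

Section DfsProgram.

Variables (n : nat) (e : rel 'I_n.+1) (N : 'I_n.+1 -> seq 'I_n.+1).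
Hypotheses (e_sym : symmetric e) (NE : forall v, N v =i e v).
Hypothesis conn : connected_graph e.

Definition dfs_state (s : state) : Prop := exists p dep ord cur k,
  dfs_inv e ord0 N p dep ord cur k /\
  [/\ reg s 2 = cur, reg s 5 = size ord & agree s 4 (fun v : 'I_n.+1 => p v)] /\
  [/\ agree s 5 dep, agree s 6 (fun v => odd (dep v)) & listed s 7 ord] /\
  (forall v : 'I_n.+1, arr s 3 v = arr s 0 v + k v /\ k v <= size (N v)) /\
  (forall v, dep v = 0 -> p v = ord0) /\
  (reg s 6 = 1 \/ [/\ reg s 6 = 0, cur = ord0 & size (N cur) <= k cur]).

(** A step costs at most 11 and the loop test 1, whence the factor 12. Scanning uses up a list
    entry, discovery pays for the greater depth with an unvisited vertex, retreating lowers the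
    depth, and stopping clears register 6. *)
Definition dfs_potential (s : state) : nat :=
  12 * (\sum_(v < n.+1) (arr s 0 v.+1 - arr s 3 v) +
        2 * (n.+1 - reg s 5) + arr s 5 (reg s 2) + reg s 6).

Lemma dfs_step_wp s : holds_graph N s -> dfs_state s -> 0 < reg s 6 ->
  wp dfs_step s (fun s' t => dfs_state s' /\ t + dfs_potential s' < dfs_potential s).
Proof.
move=> hg [p [dep [ord [cur [k [inv [[r2 r5 a4] [[a5 a6 l7] [a3 [a4' run]]]]]]]]]] r6.
have {run} r61 : reg s 6 = 1 by case: run => [//|[r60 _ _]]; rewrite r60 in r6.
have [offS adj] := hg cur; have [a3c kc] := a3 cur.
apply: vc_wp; rewrite /= r2 a3c offS ltn_add2l.
have [lt|ge] := ltnP (k cur) (size (N cur)).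
  rewrite adj //; set y := nth cur (N cur) (k cur).
  have a3' s' : (forall v : 'I_n.+1, arr s' 3 v =
        if v == cur then (arr s 0 cur + k cur).+1 else arr s 3 v) ->
      (forall i, arr s' 0 i = arr s 0 i) ->
      (forall v : 'I_n.+1, arr s' 3 v = arr s' 0 v + scan k cur v /\
         scan k cur v <= size (N v)) /\
      (\sum_(v < n.+1) (arr s' 0 v.+1 - arr s' 3 v)).+1 =
        \sum_(v < n.+1) (arr s 0 v.+1 - arr s 3 v).
    move=> s3 s0; split=> [v|].
      rewrite s3 s0 /scan; case: eqP => [->|_]; last exact: a3.
      by rewrite addnS.
    apply: (sum_drop (x := cur)) => [v /negPf vc|]; rewrite s3 s0 ?vc //.
    by rewrite eqxx a3c offS; lia.
  rewrite a5; case: eqP => dy /=.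
    have fin s' : reg s' 2 = y -> reg s' 5 = (reg s 5).+1 -> reg s' 6 = reg s 6 ->
        (forall i, arr s' 0 i = arr s 0 i) ->
        (forall v : 'I_n.+1, arr s' 3 v =
           if v == cur then (arr s 0 cur + k cur).+1 else arr s 3 v) ->
        (forall v : 'I_n.+1, arr s' 4 v = if v == y then val cur else arr s 4 v) ->
        (forall v : 'I_n.+1, arr s' 5 v = if v == y then (arr s 5 cur).+1 else arr s 5 v) ->
        (forall v : 'I_n.+1, arr s' 6 v = if v == y then ~~ odd (dep cur) : nat else arr s 6 v) ->
        (forall i, arr s' 7 i = if i == reg s 5 then val y else arr s 7 i) ->
        dfs_state s' /\ 11 + dfs_potential s' < dfs_potential s.
      move=> s2 s5 s6 s0 s3 s4 s5' s6' s7; have [k' sumE] := a3' s' s3 s0.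
      have yE : y = nth y (N cur) (k cur) by apply: set_nth_default.
      have inv' := dfs_inv_discover e_sym NE inv lt yE dy.
      have ordn : size ord < n.+1.
        have := card_uniqP (inv_uniq inv'); rewrite size_rcons => <-.
        by rewrite -[X in _ <= X]card_ord max_card.
      split; last first.
        rewrite /dfs_potential s2 s5 s6 s5' eqxx r2 r5; lia.
      do 5!eexists; split; first exact: inv'; split; last split; last split; last split.
      - by rewrite s2 s5 r5 size_rcons; split=> // v; rewrite s4 a4; case: eqP.
      - split=> [v|v|i].
        + by rewrite s5' !a5.
        + by rewrite s6' a6; case: eqP.
        + rewrite size_rcons ltnS nth_rcons s7 r5 leq_eqVlt.
          by case: (ltngtP i (size ord)) => //= h _; rewrite l7.
      - exact: k'.
      - by move=> v; case: eqP => // _; apply: a4'.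
      - by left; rewrite s6.
    by rewrite a6; case: (boolP (odd (dep cur))) => odc /=; apply: fin => //= v;
      rewrite ?odc // ?r5; case: eqP => // -> //; rewrite a6 dy.
  have [k' sumE] := a3' (set_arr (set_reg s 4 y) 3 cur (arr s 0 cur + k cur).+1)
    (fun=> erefl) (fun=> erefl).
  split; last first.
    by move: sumE; rewrite /dfs_potential /= r2; lia.
  exists p, dep, ord, cur, (scan k cur); split.
    by apply: (dfs_inv_skip inv lt (y0 := cur)); rewrite lt0n; apply/eqP.
  by do 4!split=> //; left.
case: eqP => [c0|c0].
  split; last by rewrite /dfs_potential /=; lia.
  exists p, dep, ord, cur, k; do 4!split=> //; split=> //; right; split=> //.
  exact: val_inj.
have cr : cur != ord0 by apply/eqP => E; rewrite E in c0.
have [_ _ dE _] := inv_parent inv (inv_cur inv) cr.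
split; last by rewrite /dfs_potential /= r2 a4 !a5 dE; lia.
exists p, dep, ord, (p cur), k; split; first exact: (dfs_inv_retreat NE inv ge cr).
split; first by rewrite /= a4.
by do 3!split=> //; left.
Qed.

Definition dfs_done (s : state) : Prop := exists p dep ord,
  dfs_tree e ord0 p dep /\
  [/\ uniq ord, forall v, v \in ord &
      forall v, v != ord0 -> index (p v) ord < index v ord] /\
  [/\ agree s 4 (fun v : 'I_n.+1 => p v), agree s 5 dep,
      agree s 6 (fun v => odd (dep v)) & listed s 7 ord].

Lemma dfs_prog_wp s : holds_graph N s -> reg s 0 = n.+1 ->
  (forall b i, 3 <= b -> arr s b i = 0) ->
  wp dfs_prog s (fun s' t =>
    dfs_done s' /\ t <= 100 * n.+1 + 12 * \sum_v size (N v)).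
Proof.
move=> hg r0 zero; apply: wp_seq.
apply: wp_mono (wp_for_up (n := n.+1)
  (J := fun i s1 => forall v : 'I_n.+1, arr s1 3 v = if v < i then arr s 0 v else 0)
  (T := fun=> 1) r0 _ _ _ _ _) => //=; last first.
- move=> i s1 lt Js ri [_ fa]; apply: vc_wp => /=; split=> // v.
  rewrite Js ri fa // ltnS; case: ltngtP => // -> //.
- by move=> v; rewrite zero.
move=> s1 t1 [a3 fr t1b]; have [fr_r fr_a] := fr.
have hg1 : holds_graph N s1 by apply: holds_graph_frame fr hg.
have zero1 b i : 4 <= b -> arr s1 b i = 0.
  by move=> b4; rewrite fr_a ?zero //= ?inE; lia.
apply: vc_wp => /=.
set s2 := set_reg _ 6 1.
(* Vertex 0 is the root: the cleared memory already makes it its own parent and the first entry of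
   the preorder. *)
have start : dfs_state s2.
  pose dep (v : 'I_n.+1) : nat := v == ord0.
  exists (fun=> ord0), dep, [:: ord0], ord0, (fun=> 0).
  split; first exact: dfs_inv_start.
  split; first by split=> // v; rewrite /= zero1.
  split; [split=> [v|v|[|//] _] | split; [|by split=> //; left]].
  - rewrite /= /dep -val_eqE /=; case: eqP => // _; exact: zero1.
  - rewrite /= /dep -val_eqE /=; case: eqP => // _; exact: zero1.
  - by rewrite /= zero1.
  - by move=> v; rewrite addn0 /= a3 ltn_ord fr_a.
have hg2 : holds_graph N s2 by [].
apply: wp_mono (wp_while (J := fun s => dfs_state s) (phi := dfs_potential) _ start); last first.
  move=> s3 Js fr3 r6; apply: dfs_step_wp Js r6.
  exact: holds_graph_frame fr3 hg2.
move=> s3 t3 [[p [dep [ord [cur [k [inv [[r2 r5 a4] [[a5 a6 l7] [_ [_ run]]]]]]]]]] fr3 stop ub].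
have [r6 cur0 ge] : [/\ reg s3 6 = 0, cur = ord0 & size (N cur) <= k cur].
  by case: run => // r61; move: stop; rewrite /= r61.
subst cur; have [tree [u1 u2 u3]] := dfs_inv_stop NE inv ge conn.
split; first by exists p, dep, ord.
have sumE : \sum_(v < n.+1) (arr s2 0 v.+1 - arr s2 3 v) = \sum_v size (N v).
  apply: eq_bigr => v _; have [-> _] := hg2 v.
  by rewrite /= a3 ltn_ord fr_a //; lia.
move: ub t1b; rewrite /dfs_potential sumE /= sum_nat_const card_ord; lia.
Qed.

End DfsProgram.

(** * Cutting the tree into pieces *)

Section LowInvariant.

Variables (T : finType) (e : rel T) (r : T) (p : T -> T) (dep : T -> nat).
Hypothesis tree : dfs_tree e r p dep.

(** Only vertices of [D] have a final [req], so only their links to the parent are settled. *)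
Definition hang_in (D : pred T) (req : T -> nat) (z a : T) : bool :=
  connect (fun u v => [&& D u, ~~ severed p dep req u & p u == v]) z a.

(* [D]: vertices whose values were passed on to their parents; [S x y]: the
   entry [y] of the list of [x] was scanned. *)
Record low_inv (D : pred T) (S : rel T) (req : T -> nat) (g : T -> bool) : Prop := LowInv {
  low_bad : forall x y, S x y -> bad e dep x y -> dep y <= req x;
  low_pass : forall c, D c -> ~~ severed p dep req c -> req c <= req (p c);
  low_attained : forall a, 0 < req a ->
    exists z y, [/\ hang_in D req z a, bad e dep z y & dep y = req a];
  low_lt : forall v, req v < dep v;
  low_good : forall x y, S x y -> good e p dep x y -> g x;
  low_gpass : forall c, D c -> ~~ severed p dep req c -> g c -> g (p c);
  low_gattained : forall a, g a -> exists z y, hang_in D req z a /\ good e p dep z y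
}.

Lemma hang_in_sub (D D' : pred T) req req' z a :
  (forall u, D u -> D' u /\ req' u = req u) ->
  hang_in D req z a -> hang_in D' req' z a.
Proof.
move=> sub; apply: connect_sub => u v /and3P[Du su uv]; apply: connect1.
by have [D'u ru] := sub u Du; rewrite D'u uv /severed ru su.
Qed.

Lemma low_inv_start (D : pred T) (S : rel T) req g :
  (forall v, D v = false) -> (forall u v, S u v = false) ->
  (forall v, req v = 0) -> (forall v, g v = false) -> low_inv D S req g.
Proof.
move=> D0 S0 r0 g0; split=> [x y|c|a|v|x y|c|a]; rewrite ?S0 ?D0 ?r0 ?g0 //.
exact: dep_gt0 tree v.
Qed.

Lemma low_inv_sub D (S S' : rel T) req g :
  (forall u v, S' u v -> S u v) -> low_inv D S req g -> low_inv D S' req g.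
Proof. by move=> sub [l1 l2 l3 l4 l5 l6 l7]; split=> // x y /sub; [apply: l1 | apply: l5]. Qed.

Lemma low_inv_ext D S req g req' g' : req' =1 req -> g' =1 g ->
  low_inv D S req g -> low_inv D S req' g'.
Proof.
move=> rE gE [l1 l2 l3 l4 l5 l6 l7].
have hE z a : hang_in D req z a -> hang_in D req' z a by apply: hang_in_sub.
split.
- by move=> x y sxy b; rewrite rE; apply: l1.
- by move=> c Dc; rewrite /severed !rE; apply: l2.
- by move=> a; rewrite rE => /l3[z [y [/hE h b d]]]; exists z, y.
- by move=> v; rewrite rE.
- by move=> x y sxy b; rewrite gE; apply: l5 b.
- by move=> c Dc; rewrite /severed !rE !gE; apply: l6.
- by move=> a; rewrite gE => /l7[z [y [/hE h b]]]; exists z, y.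
Qed.

Lemma low_inv_scan D S (S' : rel T) req g x y : low_inv D S req g ->
  (bad e dep x y -> dep y <= req x) -> (good e p dep x y -> g x) ->
  (forall u v, S' u v -> S u v \/ u = x /\ v = y) ->
  low_inv D S' req g.
Proof.
move=> [l1 l2 l3 l4 l5 l6 l7] hb hg sub; split=> // u v /sub[|[-> ->]] //.
- exact: l1.
- exact: l5.
Qed.

(** As [x] is outside [D], raising [req x] affects no settled link, and [x] itself witnesses the new
    value. *)
Lemma low_inv_bad D S req g req' x y : low_inv D S req g -> ~~ D x ->
  bad e dep x y -> req x < dep y ->
  (forall v, req' v = if v == x then dep y else req v) -> low_inv D S req' g.
Proof.
move=> [l1 l2 l3 l4 l5 l6 l7] Dx bxy lt rE.
have same u : D u -> D u /\ req' u = req u.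
  by move=> Du; rewrite rE; case: eqP => // ux; rewrite -ux Du in Dx.
have sev u : D u -> severed p dep req' u = severed p dep req u.
  by move=> /same[_ ru]; rewrite /severed ru.
have ge u : req u <= req' u by rewrite rE; case: eqP => // ->; apply: ltnW.
have hE z a : hang_in D req z a -> hang_in D req' z a by apply: hang_in_sub.
split=> //.
- by move=> u v suv b; apply: leq_trans (ge u); apply: l1.
- by move=> c Dc; rewrite sev // => sc; rewrite (same c Dc).2; apply: leq_trans (ge _); apply: l2.
- move=> a; rewrite rE; case: eqP => [-> _|_ /l3[z [v [h b d]]]].
    by exists x, y; split=> //; apply: connect0.
  by exists z, v; split=> //; apply: hE.
- move=> v; rewrite rE; case: eqP => // ->.
  by case/andP: bxy; rewrite inE => /andP[].
- by move=> c Dc; rewrite sev //; apply: l6.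
- by move=> a /l7[z [v [/hE h b]]]; exists z, v.
Qed.

Lemma low_inv_good D S req g g' x y : low_inv D S req g -> ~~ D x ->
  good e p dep x y ->
  (forall v, g' v = (v == x) || g v) -> low_inv D S req g'.
Proof.
move=> [l1 l2 l3 l4 l5 l6 l7] Dx gxy gE; split=> //.
- by move=> u v suv b; rewrite gE (l5 u v) ?orbT.
- move=> c Dc sc; rewrite !gE => /orP[/eqP cx|gc]; last by rewrite l6 ?orbT.
  by rewrite -cx Dc in Dx.
- move=> a; rewrite gE => /orP[/eqP ->|/l7 //].
  by exists x, y; split=> //; apply: connect0.
Qed.

(** The parent must still be open, so that its value may grow. The root is its own parent and merely
    takes a maximum with itself. *)
Lemma low_inv_close D S req g (D' : pred T) req' g' x : low_inv D S req g ->
  (forall v, D' v = (v == x) || D v) -> ~~ D' (p x) || (x == r) ->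
  (forall u v, D' u -> e u v -> S u v) ->
  (forall v, req' v = if (v == p x) && ~~ severed p dep req x
                      then maxn (req v) (req x) else req v) ->
  (forall v, g' v = g v || [&& v == p x, ~~ severed p dep req x & g x]) ->
  low_inv D' (fun u _ => D' u) req' g'.
Proof.
move=> [l1 l2 l3 l4 l5 l6 l7] D'E Dpx all rE gE.
have ge u : req u <= req' u by rewrite rE; case: ifP => // _; apply: leq_maxl.
have same u : D' u -> req' u = req u.
  move=> D'u; rewrite rE; case: eqP => //= up; case: ifP => // sx.
  have xr : x = r by move: Dpx; rewrite -up D'u /= => /eqP.
  by rewrite up xr (tree_root tree) maxnn.
have sev u : D' u -> severed p dep req' u = severed p dep req u.
  by move=> /same ru; rewrite /severed ru.
have hE z a : hang_in D req z a -> hang_in D' req' z a.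
  apply: hang_in_sub => u Du; have D'u : D' u by rewrite D'E Du orbT.
  by rewrite same.
have D'x : D' x by rewrite D'E eqxx.
have up_edge z y : bad e dep z y -> e z y by case/andP; rewrite inE => /andP[].
have up_edge' z y : good e p dep z y -> e z y by case/and3P; rewrite inE => /andP[].
have step z : hang_in D' req' z x -> ~~ severed p dep req x -> hang_in D' req' z (p x).
  by move=> h sx; apply: connect_trans h (connect1 _); rewrite D'x sev // sx eqxx.
split.
- by move=> u v D'u b; apply: leq_trans (ge u); apply: l1 (b); apply: all (up_edge _ _ b).
- move=> c D'c; rewrite sev // => sc; rewrite same //.
  move: D'c; rewrite D'E => /orP[/eqP cx|Dc].
    by rewrite cx in sc *; rewrite rE eqxx sc leq_maxr.
  by apply: leq_trans (ge _); apply: l2.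
- move=> a; rewrite rE; case: ifP => [/andP[/eqP -> sx]|_ /l3[z [y [/hE h b d]]]]; last first.
    by exists z, y.
  case: (leqP (req (p x)) (req x)) => _ /l3[z [y [/hE h b d]]];
    exists z, y; split=> //.
  exact: step.
- move=> v; rewrite rE; case: ifP => [/andP[/eqP -> sx]|//].
  rewrite gtn_max l4 /=; have [xr|xr] := eqVneq x r.
    by rewrite xr (tree_root tree) l4.
  (* Below the root, [req x <= dep (p x)], and equality would have severed [x]. *)
  have := l4 x; rewrite (dep_parent tree xr) ltnS leq_eqVlt => /orP[/eqP E|//].
  by move: sx; rewrite /severed E eqxx.
- by move=> u v D'u b; rewrite gE (l5 u v) //; apply: all (up_edge' _ _ b).
- move=> c D'c; rewrite sev // => sc; rewrite !gE => /orP[gc|].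
    move: D'c; rewrite D'E => /orP[/eqP cx|Dc]; last by rewrite l6.
    by rewrite cx in sc gc *; rewrite eqxx sc gc orbT.
  move=> /and3P[/eqP cp sx gx].
  have xr : x = r by move: Dpx; rewrite -cp D'c /= => /eqP.
  by rewrite cp xr !(tree_root tree) -xr gx.
- move=> a; rewrite gE => /orP[/l7[z [y [/hE h b]]]|/and3P[/eqP -> sx /l7[z [y [/hE h b]]]]].
    by exists z, y.
  by exists z, y; split=> //; apply: step.
Qed.

(** Once every vertex is closed, all links are settled, and the upper bounds propagate along
    unsevered links. *)
Lemma low_inv_end (D : pred T) req g : (forall v, D v) ->
  low_inv D (fun u _ => D u) req g ->
  [/\ forall v, req v < dep v,
      forall z a y, hang p dep req z a -> bad e dep z y -> dep y <= req a,
      forall a, 0 < req a -> exists z y,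
        [/\ hang p dep req z a, bad e dep z y & dep y = req a]
    & forall a, g a <-> exists z y, hang p dep req z a /\ good e p dep z y].
Proof.
move=> DT [l1 l2 l3 l4 l5 l6 l7].
have hE z a : hang_in D req z a -> hang p dep req z a.
  by apply: connect_sub => u v /and3P[_ su uv]; apply: connect1; rewrite su uv.
split=> //.
- move=> z a y h b; apply: leq_trans (l1 z y (DT z) b) _.
  case/connectP: h => s + ->; elim: s z {b} => //= u s IH z.
  by move=> /andP[/andP[sz /eqP <-] hs]; apply: leq_trans (l2 z _ sz) (IH _ hs).
- by move=> a /l3[z [y [/hE h b d]]]; exists z, y.
move=> a; split=> [/l7[z [y [/hE h b]]]|[z [y [h b]]]]; first by exists z, y.
have gz := l5 z y (DT z) b.
case/connectP: h => s + ->; elim: s z gz {b} => //= u s IH z gz.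
by move=> /andP[/andP[sz /eqP zu] hs]; apply: IH hs; rewrite -zu; apply: l6.
Qed.

End LowInvariant.

Definition low_scan : com :=
  If (Lt (Read 5 (Reg 4)) (Read 5 (Reg 2)))
     (If (Eq (Read 6 (Reg 4)) (Read 6 (Reg 2)))
         (If (Lt (Read 8 (Reg 2)) (Read 5 (Reg 4)))
             (Store 8 (Reg 2) (Read 5 (Reg 4))) Skip)
         (If (Eq (Reg 4) (Read 4 (Reg 2))) Skip (Store 9 (Reg 2) (Const 1))))
     Skip.

Definition low_body : com :=
  Seq (Assign 2 (Read 7 (Reg 1)))
  (Seq (for_adj low_scan)
       (If (Eq (Read 8 (Reg 2)) (Read 5 (Read 4 (Reg 2)))) Skip
           (Seq (If (Lt (Read 8 (Read 4 (Reg 2))) (Read 8 (Reg 2)))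
                    (Store 8 (Read 4 (Reg 2)) (Read 8 (Reg 2))) Skip)
                (If (Eq (Read 9 (Reg 2)) (Const 0)) Skip
                    (Store 9 (Read 4 (Reg 2)) (Const 1)))))).

Definition low_prog : com := for_down 1 low_body.

(** * Passes along the preorder *)

Section Passes.

Variables (n : nat) (e : rel 'I_n.+1) (N : 'I_n.+1 -> seq 'I_n.+1).
Hypotheses (e_sym : symmetric e) (e_irr : irreflexive e).
Hypotheses (NE : forall v, N v =i e v) (N_uniq : forall v, uniq (N v)).
Variables (p : 'I_n.+1 -> 'I_n.+1) (dep : 'I_n.+1 -> nat) (ord : seq 'I_n.+1).
Hypothesis tree : dfs_tree e ord0 p dep.
Hypotheses (ord_uniq : uniq ord) (ord_all : forall v, v \in ord).
Hypothesis ord_parent : forall v, v != ord0 -> index (p v) ord < index v ord.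

Definition tree_state (s : state) : Prop :=
  [/\ holds_graph N s, reg s 0 = n.+1, agree s 4 (fun v : 'I_n.+1 => p v),
      agree s 5 dep & agree s 6 (fun v => odd (dep v)) /\ listed s 7 ord].

Lemma tree_state_frame c s s' :
  ~~ has (mem (warrs c)) [:: 0; 1; 4; 5; 6; 7] -> 0 \notin wregs c ->
  frame c s s' -> tree_state s -> tree_state s'.
Proof.
rewrite /= !negb_or => /and5P[a0 a1 a4 a5 /and3P[a6 a7 _]] r0 fr.
move=> [hg rn p4 p5 [p6 p7]]; have [f1 f2] := fr; split.
- exact: holds_graph_frame fr hg.
- by rewrite f1.
- by move=> v; rewrite f2.
- by move=> v; rewrite f2.
- by split=> [v|i h]; rewrite f2 //; apply: p7.
Qed.

Lemma size_ord : size ord = n.+1.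
Proof.
rewrite -(card_uniqP ord_uniq) -[RHS]card_ord; apply: eq_card => v.
by rewrite ord_all.
Qed.

Lemma index_ord v : index v ord < n.+1.
Proof. by have := ord_all v; rewrite -index_mem size_ord. Qed.

Lemma sum_ord (F : 'I_n.+1 -> nat) :
  \sum_(k < n.+1) F (nth ord0 ord k) = \sum_v F v.
Proof.
transitivity (\sum_(v <- ord) F v).
  by rewrite (big_nth ord0) size_ord big_mkord.
apply: perm_big; apply: uniq_perm => // [|v]; first exact: index_enum_uniq.
by rewrite ord_all mem_index_enum.
Qed.

(** The vertices already handled when the preorder is traversed backwards; descendants are handled
    before their ancestors. *)
Definition since (i : nat) (v : 'I_n.+1) : bool := i <= index v ord.

Lemma since_step k v : k < n.+1 ->
  since k v = (v == nth ord0 ord k) || since k.+1 v.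
Proof.
move=> kn'; have kn : k < size ord by rewrite size_ord.
rewrite /since leq_eqVlt; congr (_ || _).
apply/eqP/eqP => [->|->]; first by rewrite nth_index.
by rewrite index_uniq.
Qed.

Lemma since_parent k : k < n.+1 ->
  ~~ since k (p (nth ord0 ord k)) || (nth ord0 ord k == ord0).
Proof.
move=> kn'; have kn : k < size ord by rewrite size_ord.
case: eqP => [|/eqP x0]; rewrite ?orbT // orbF.
by rewrite /since -ltnNge; have := ord_parent x0; rewrite index_uniq.
Qed.

Definition low_state (D : pred 'I_n.+1) (S : rel 'I_n.+1) (s : state) : Prop :=
  low_inv e p dep D S (fun v => arr s 8 v) (fun v => arr s 9 v != 0).

Lemma low_scan_wp D (S S' : rel 'I_n.+1) s (x y : 'I_n.+1) :
  tree_state s -> reg s 2 = x -> ~~ D x -> e x y ->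
  low_state D S s -> (forall u v, S' u v -> S u v \/ u = x /\ v = y) ->
  wp low_scan (set_reg s 4 y)
    (fun s' t => low_state D S' (set_reg s' 3 (reg s' 3).+1) /\ t <= 4).
Proof.
move=> [hg rn p4 p5 [p6 p7]] r2 Dx exy inv sub; apply: vc_wp.
rewrite /= r2 (p5 y) (p5 x) (p6 y) (p6 x) (p4 x).
have upE : ((x, y) \in up e dep) = (dep y < dep x) by rewrite inE /= exy.
have oE : (odd (dep y) == odd (dep x) :> nat) = (odd (dep x) == odd (dep y)).
  by case: (odd _); case: (odd _).
have [lt|ge] := ltnP (dep y) (dep x); last first.
  by split=> //; apply: low_inv_scan inv _ _ sub; rewrite /bad /good upE ltnNge ge.
rewrite oE; case: ifPn => o.
  have bxy : bad e dep x y by rewrite /bad upE lt.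
  have ngood : ~~ good e p dep x y by rewrite /good o andbF.
  case: ifPn => /= [lt'|ge']; split=> //.
    have inv' := low_inv_bad inv Dx bxy lt' (fun v => erefl).
    apply: (low_inv_scan (x := x) (y := y)) sub => [|_|/(negP ngood) //].
      by apply: low_inv_ext inv' => v.
    by rewrite /= eqxx.
  by apply: low_inv_scan inv _ _ sub => [_|/(negP ngood) //]; rewrite leqNgt.
have nbad : ~~ bad e dep x y by rewrite /bad negb_and o orbT.
case: eqP => /= yp; split=> //.
  apply: low_inv_scan inv _ _ sub => [/(negP nbad) //|].
  by case/and3P => _ _ /eqP; case; apply: val_inj.
have gxy : good e p dep x y by rewrite /good upE lt o; apply/eqP => E; apply: yp; rewrite E.
have inv' := low_inv_good inv Dx gxy (fun v => erefl).
apply: (low_inv_scan (x := x) (y := y)) sub => [|/(negP nbad) //|_].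
  apply: low_inv_ext inv' => v //=.
  by have -> : (v == x) = (nat_of_ord v == x) by []; case: (nat_of_ord v == x).
by rewrite /= eqxx.
Qed.

Lemma tree_state_reg s x v : x != 0 -> tree_state s -> tree_state (set_reg s x v).
Proof.
move=> x0; apply: (tree_state_frame (c := Assign x (Const v))) => //=.
  by rewrite inE eq_sym.
exact: exec_frame (exec_assign _ _ _).
Qed.

Lemma ord_nth s k : tree_state s -> k < n.+1 -> arr s 7 k = nth ord0 ord k.
Proof. by move=> [_ _ _ _ [_ h]] kn; apply: h; rewrite size_ord. Qed.

Lemma low_body_wp k s : k < n.+1 -> tree_state s -> reg s 1 = k ->
  low_state (since k.+1) (fun u _ => since k.+1 u) s ->
  wp low_body s (fun s' t => low_state (since k) (fun u _ => since k u) s' /\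
    t <= 8 + size (N (nth ord0 ord k)) * 7).
Proof.
move=> kn st r1 inv; set x := nth ord0 ord k.
have Dx : ~~ since k.+1 x by rewrite /since /x index_uniq ?size_ord // ltnn.
apply: wp_seq; apply: vc_wp; rewrite /= r1 (ord_nth st kn) -/x; apply: wp_seq.
have {st}st := @tree_state_reg _ 2 x isT st.
have hg : holds_graph N (set_reg s 2 x) by case: st.
apply: wp_mono (wp_for_adj (T := 4) (x := x)
  (J := fun l => low_state (since k.+1)
     (fun u v => since k.+1 u || (u == x) && (v \in l))) hg erefl _ _ _ _ _ _) => //=.
- move=> s1 t1 [inv1 fr t1b].
  have [hg1 rn1 p4 p5 [p6 _]] : tree_state s1 by apply: tree_state_frame fr st.
  have r2 : reg s1 2 = x by rewrite (fr.1 2).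
  have all u v : since k u -> e u v -> since k.+1 u || (u == x) && (v \in N x).
    rewrite since_step // => /orP[/eqP -> exv|->//].
    by rewrite eqxx NE -topredE /= exv orbT.
  have sinceE v : since k v = (v == x) || since k.+1 v by apply: since_step.
  have fin s' : (forall v : 'I_n.+1, arr s' 8 v =
        if (v == p x :> nat) && (arr s1 8 x != dep (p x))
        then maxn (arr s1 8 v) (arr s1 8 x) else arr s1 8 v) ->
      (forall v : 'I_n.+1, (arr s' 9 v != 0) = (arr s1 9 v != 0) ||
        [&& v == p x :> nat, arr s1 8 x != dep (p x) & arr s1 9 x != 0]) ->
      low_state (since k) (fun u _ => since k u) s'.
    by move=> h8 h9; apply: (low_inv_close tree inv1 sinceE (since_parent kn) all).
  apply: vc_wp; rewrite /= r2 (p4 x) (p5 (p x)).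
  case: ifPn => sev /=.
    by split; [apply: fin => v; rewrite sev ?andbF ?orbF | lia].
  have maxE v : (if (v == p x :> nat) && true then maxn (arr s1 8 v) (arr s1 8 x)
      else arr s1 8 v) = if v == p x :> nat then maxn (arr s1 8 (p x)) (arr s1 8 x)
      else arr s1 8 v by rewrite andbT; case: eqP => // ->.
  case: ifPn => rlt /=; case: eqP => g0 /=; (split; last by lia); apply: fin => v /=;
    rewrite sev ?maxE ?g0 ?andbF ?orbF //.
  - by rewrite (maxn_idPr (ltnW rlt)).
  - by rewrite (maxn_idPr (ltnW rlt)).
  - by have /eqP -> := g0; case: (nat_of_ord v == p x); rewrite ?orbT ?orbF.
  - by case: eqP => // ->; rewrite (maxn_idPl _) // leqNgt.
  - by case: eqP => // ->; rewrite (maxn_idPl _) // leqNgt.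
  - by have /eqP -> := g0; case: (nat_of_ord v == p x); rewrite ?orbT ?orbF.
- by apply: low_inv_sub inv => u v; rewrite in_nil andbF orbF.
- move=> l y l' s1 Nx inv1 r2 fr.
  apply: (low_scan_wp (x := x)) inv1 _ => //.
  + exact: tree_state_frame fr st.
  + by have := NE x y; rewrite Nx mem_cat mem_head orbT.
  + move=> u v; rewrite mem_rcons inE => /orP[->|/andP[/eqP -> /orP[/eqP ->|vl]]]; first by left.
      by right.
    by left; rewrite eqxx vl orbT.
Qed.

Lemma low_prog_wp s : tree_state s -> (forall b i, 8 <= b -> arr s b i = 0) ->
  wp low_prog s (fun s' t =>
    [/\ tree_state s', frame low_prog s s',
        low_state (since 0) (fun u _ => since 0 u) s' &
        t <= 10 * n.+1 + 7 * \sum_v size (N v) + 2]).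
Proof.
move=> st zero; have rn : reg s 0 = n.+1 by case: st.
apply: wp_mono (wp_for_down (J := fun k => low_state (since k) (fun u _ => since k u))
  (T := fun k => 8 + size (N (nth ord0 ord k)) * 7) rn _ _ _) => //=.
- move=> s' t [inv fr tb]; split=> //.
  + exact: tree_state_frame fr st.
  + apply: leq_trans tb _.
    rewrite (eq_bigr (fun k : 'I_n.+1 => 10 + 7 * size (N (nth ord0 ord k)))); last first.
      by move=> k _; rewrite addnAC mulnC.
    rewrite big_split /= -big_distrr /= (sum_ord (fun v => size (N v))) sum_nat_const card_ord.
    by rewrite [n.+1 * 10]mulnC addnC.
- have D0 v : since n.+1 v = false.
    by apply/negbTE; rewrite /since -ltnNge index_ord.
  by apply: (low_inv_start tree) => // v; rewrite /= zero.
- move=> k s1 kn inv fr.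
  have st1 : tree_state (set_reg s1 1 k).
    by apply: tree_state_reg => //; apply: tree_state_frame fr st.
  by apply: wp_mono (low_body_wp kn st1 erefl inv) => s' t [].
Qed.

(** * Forward pass: roots of pieces and switched branches *)

Definition piece_body : com :=
  Seq (Assign 2 (Read 7 (Reg 1)))
  (Seq (If (Eq (Read 8 (Reg 2)) (Read 5 (Read 4 (Reg 2))))
           (Seq (Store 10 (Reg 2) (Reg 2)) (Store 11 (Reg 2) (Const 0)))
           (Seq (Store 10 (Reg 2) (Read 10 (Read 4 (Reg 2))))
                (Store 11 (Reg 2) (Read 11 (Read 4 (Reg 2))))))
       (If (And (Eq (Read 9 (Reg 2)) (Const 0)) (Lt (Const 0) (Read 8 (Reg 2))))
           (Store 11 (Reg 2) (Const 1)) Skip)).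

Definition piece_prog : com := for_up 1 piece_body.

Section Pieces.

Variables (req : 'I_n.+1 -> nat) (g : 'I_n.+1 -> bool).
Hypothesis req_lt : forall v, req v < dep v.
Let sev := severed p dep req.

Definition low_done (s : state) : Prop :=
  [/\ tree_state s, agree s 8 req & forall v : 'I_n.+1, (arr s 9 v != 0) = g v].

Definition piece_eq (s : state) (v : 'I_n.+1) : Prop :=
  arr s 10 v = (if sev v then v : nat else arr s 10 (p v)) /\
  (arr s 11 v != 0) = ~~ g v && (0 < req v) || ~~ sev v && (arr s 11 (p v) != 0).

(** Entries of array 10 are kept in range so that they can finally be read as vertices. *)
Definition piece_inv (i : nat) (s : state) : Prop :=
  [/\ forall v : 'I_n.+1, arr s 10 v < n.+1,
      arr s 10 0 = 0 /\ arr s 11 0 = 0 &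
      forall v, index v ord < i -> piece_eq s v].

Definition piece_done (s : state) : Prop := exists pc F,
  [/\ agree s 10 (fun v : 'I_n.+1 => pc v : 'I_n.+1),
      forall v, pc v = if sev v then v else pc (p v), pc ord0 = ord0,
      forall v : 'I_n.+1, (arr s 11 v != 0) = F v &
      (forall v, F v = ~~ g v && (0 < req v) || ~~ sev v && F (p v)) /\ F ord0 = false].

Lemma piece_body_wp k s : k < n.+1 -> low_done s -> reg s 1 = k -> piece_inv k s ->
  wp piece_body s (fun s' t => piece_inv k.+1 (set_reg s' 1 k.+1) /\ t <= 7).
Proof.
move=> kn [st a8 a9] r1 [lt [z10 z11] eqs]; set x := nth ord0 ord k.
have kn' : k < size ord by rewrite size_ord.
have idx : index x ord = k by rewrite index_uniq.
have [_ _ p4 p5 _] := st.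
have fin s' : (forall v : 'I_n.+1, arr s' 10 v = if v == x
      then if sev x then x : nat else arr s 10 (p x) else arr s 10 v) ->
    (forall v : 'I_n.+1, arr s' 11 v = if v == x
      then if ~~ g x && (0 < req x) then 1
           else if sev x then 0 else arr s 11 (p x)
      else arr s 11 v) -> piece_inv k.+1 s'.
  move=> s10 s11.
  (* At the root, which is its own parent, the program copies the zeros of cells 0 onto themselves;
     hence [pc_root] and [F_root]. *)
  have root : x = ord0 -> sev x = false /\ req x = 0.
    move=> x0; rewrite x0 /sev (severed_root tree req_lt); split=> //.
    by have := req_lt ord0; rewrite (dep_root tree); case: (req _).
  have s100 : arr s' 10 0 = 0.
    have := s10 ord0; case: (ord0 =P x) => [x0|_ ->]; last exact: z10.
    by have [-> _] := root (esym x0); rewrite -x0 (tree_root tree) => ->.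
  have s110 : arr s' 11 0 = 0.
    have := s11 ord0; case: (ord0 =P x) => [x0|_ ->]; last exact: z11.
    by have [-> ->] := root (esym x0); rewrite andbF -x0 (tree_root tree) => ->.
  split=> // [v|v].
    by rewrite s10; case: eqP => // _; case: ifP.
  rewrite ltnS leq_eqVlt => /orP[/eqP vk|vk].
    have vx : v = x by rewrite /x -vk nth_index.
    rewrite /piece_eq vx s10 s11 eqxx.
    have [x0|x0] := eqVneq x ord0.
      have [sx rx] := root x0; rewrite sx rx x0 (tree_root tree) /= andbF.
      by rewrite s100 s110 z10 z11.
    have px : (p x == x) = false.
      by apply/eqP => E; have := ord_parent x0; rewrite E ltnn.
    rewrite s10 s11 px; split=> //.
    by case: (sev x); case: (_ && _) => //=; rewrite ?orbF.
  have vx : (v == x) = false by apply: contraTF vk => /eqP ->; rewrite idx ltnn.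
  have pvx : (p v == x) = false.
    have [v0|v0] := eqVneq v ord0; first by rewrite v0 (tree_root tree) -v0.
    apply: contraTF vk => /eqP pv; rewrite -leqNgt -idx -pv.
    exact: ltnW (ord_parent v0).
  by rewrite /piece_eq s10 s11 vx s10 s11 pvx; apply: eqs.
have pE (v : 'I_n.+1) : (v == x) = (nat_of_ord v == x) by [].
apply: vc_wp; rewrite /= r1 (ord_nth st kn) -/x (p4 x) (p5 (p x)) (a8 x).
rewrite -/(severed p dep req x) -/(sev x).
have gx := a9 x; have {gx} gx : (arr s 9 x == 0) = ~~ g x by rewrite -gx negbK.
case sx : (sev x) => /=; rewrite ?(a8 x) gx; case cx : (_ && _) => /=; split=> //;
  apply: fin => v; rewrite /= ?sx ?cx pE //=; by case: (nat_of_ord v == x).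
Qed.

Lemma piece_prog_wp s : low_done s -> (forall b i, 10 <= b -> arr s b i = 0) ->
  wp piece_prog s (fun s' t =>
    [/\ low_done s', frame piece_prog s s', piece_done s' & t <= 9 * n.+1 + 2]).
Proof.
move=> ld zero; have rn : reg s 0 = n.+1 by case: ld => -[].
have ld_frame s' : frame piece_prog s s' -> low_done s'.
  case: ld => st a8 a9 fr; split; first exact: tree_state_frame fr st.
    by move=> v; rewrite fr.2.
  by move=> v; rewrite fr.2.
apply: wp_mono (wp_for_up (n := n.+1) (J := piece_inv) (T := fun=> 7) rn _ _ _ _ _) => //=.
- move=> s' t [[lt [z10 z11] eqs] fr tb]; split=> //; first exact: ld_frame.
    exists (fun v => inord (arr s' 10 v)), (fun v => arr s' 11 v != 0).
    have eqs' v : piece_eq s' v by apply: eqs; apply: index_ord.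
    split=> // [v|v||].
    + by rewrite inordK.
    + by rewrite (eqs' v).1; case: ifP => // _; rewrite inord_val.
    + by rewrite z10; apply: val_inj; rewrite /= inordK.
    + by split=> [v|]; [exact: (eqs' v).2 | rewrite z11].
  by apply: leq_trans tb _; rewrite sum_nat_const card_ord; lia.
- by split=> [v||//]; rewrite /= !zero.
- move=> k s1 kn inv r1 fr.
  exact: piece_body_wp (ld_frame _ fr) r1 inv.
Qed.

(** * Orienting the pieces *)

Definition bump (b : nat) : com :=
  Store b (Read 10 (Reg 2)) (Succ (Read b (Read 10 (Reg 2)))).

(** The label of the neighbour is final, while the current vertex is taken with its piece not yet
    turned over. Array 13 counts equal labels, array 12 different ones. *)
Definition orient_scan : com :=
  If (And (Lt (Read 5 (Reg 2)) (Read 5 (Reg 4)))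
          (Not (Eq (Read 10 (Reg 2)) (Read 10 (Reg 4)))))
     (If (Eq (Read 6 (Reg 4)) (Read 14 (Read 10 (Reg 4))))
         (If (Eq (Read 6 (Reg 2)) (Const 0)) (bump 13) (bump 12))
         (If (Eq (Read 6 (Reg 2)) (Const 0)) (bump 12) (bump 13)))
     Skip.

Definition orient_body : com :=
  Seq (Assign 2 (Read 7 (Reg 1)))
  (Seq (for_adj orient_scan)
       (If (Lt (Read 12 (Reg 2)) (Read 13 (Reg 2)))
           (Store 14 (Reg 2) (Const 1)) (Store 14 (Reg 2) (Const 0)))).

Definition orient_prog : com := for_down 1 orient_body.

Section Orient.

Variables (pc : 'I_n.+1 -> 'I_n.+1).
Hypotheses (pcE : forall v, pc v = if sev v then v else pc (p v)) (pc_root : pc ord0 = ord0).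

Definition piece_state (s : state) : Prop :=
  tree_state s /\ agree s 10 (fun v : 'I_n.+1 => pc v : 'I_n.+1).

Definition crossing (flip : 'I_n.+1 -> bool) (b : bool) (y x : 'I_n.+1) : bool :=
  [&& dep y < dep x, pc x != pc y & (odd (dep y) == odd (dep x) (+) flip (pc x)) == b].

Lemma count_N (P : pred 'I_n.+1) v : count P (N v) = #|[set x | e v x & P x]|.
Proof.
rewrite -size_filter -(card_uniqP _) ?filter_uniq //.
by apply: eq_card => x; rewrite mem_filter inE NE andbC.
Qed.

Lemma anc_index a b : anc p a b -> index a ord <= index b ord.
Proof.
elim/(tree_ind tree): b => b IH /(ancP tree)[->//|[b0 /(IH b0)]] h.
exact: leq_trans h (ltnW (ord_parent b0)).
Qed.

Lemma pc_index v : index (pc v) ord <= index v ord.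
Proof. exact: anc_index (hang_anc tree (pc_hang tree pcE pc_root v)). Qed.

(** By [anc_pc], [y] is an ancestor of the parent of [pc x], hence comes earlier in the preorder.
    Backwards, the lower piece is oriented before [y] is scanned. *)
Lemma crossing_index flip b y x : e y x -> crossing flip b y x ->
  index y ord < index (pc x) ord.
Proof.
move=> eyx /and3P[d pxy _].
have yx : anc p y x by apply: (up_anc tree); rewrite inE /= e_sym eyx.
case: (anc_pc tree req_lt pcE pc_root yx) => [E|[sx h]].
  by rewrite E eqxx in pxy.
exact: leq_ltn_trans (anc_index h) (ord_parent (severed_neq tree req_lt sx)).
Qed.

Definition flip_of (s : state) (v : 'I_n.+1) : bool := arr s 14 v != 0.

Definition partial_tally (D : pred 'I_n.+1) (flip : 'I_n.+1 -> bool) c b : nat :=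
  \sum_(y | D y && (pc y == c)) count (crossing flip b y) (N y).

(** The first clause forces the entries of array 14 to be 0 or 1, since the program compares them
    with parities. *)
Definition orient_inv (k : nat) (s : state) : Prop :=
  [/\ forall v : 'I_n.+1, arr s 14 v = flip_of s v,
      forall c : 'I_n.+1, arr s 12 c = partial_tally (since k) (flip_of s) c false /\
        arr s 13 c = partial_tally (since k) (flip_of s) c true &
      forall c : 'I_n.+1, since k c -> flip_of s c = (arr s 12 c < arr s 13 c)].

Lemma orient_scan_wp s (x y : 'I_n.+1) : piece_state s -> reg s 2 = x ->
  (forall v : 'I_n.+1, arr s 14 v = flip_of s v) ->
  wp orient_scan (set_reg s 4 y) (fun s' t =>
    (forall c : 'I_n.+1,
      arr s' 12 c = arr s 12 c + (pc x == c) * crossing (flip_of s) false x y /\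
      arr s' 13 c = arr s 13 c + (pc x == c) * crossing (flip_of s) true x y) /\ t <= 4).
Proof.
move=> [[_ _ _ p5 [p6 _]] p10] r2 f14.
apply: vc_wp; rewrite /= r2 (p5 x) (p5 y) (p6 x) (p6 y) (p10 x) (p10 y) (f14 (pc y)).
have pE : (nat_of_ord (pc x) == pc y) = (pc y == pc x).
  by rewrite eq_sym.
have cE c : (nat_of_ord c == pc x) = (pc x == c) by rewrite eq_sym.
rewrite /crossing pE.
have [d|d] := ltnP (dep x) (dep y); last by split=> // c; rewrite !muln0 !addn0.
case: eqP => /= pxy; first by split=> // c; rewrite !muln0 !addn0.
by case: (odd (dep y)); case: (flip_of s (pc y)); case: (odd (dep x)) => /=;
  split=> // c; rewrite ?muln0 ?muln1 ?addn0; split=> //=; rewrite cE;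
  case: eqP => [<-|_]; rewrite ?addn0 ?addn1.
Qed.

Lemma orient_body_wp k s : k < n.+1 -> piece_state s -> reg s 1 = k ->
  orient_inv k.+1 s ->
  wp orient_body s (fun s' t => orient_inv k s' /\
    t <= 5 + size (N (nth ord0 ord k)) * 7).
Proof.
move=> kn ps r1 [f14 tal done]; set x := nth ord0 ord k.
have st := ps.1; have kn' : k < size ord by rewrite size_ord.
have idx : index x ord = k by rewrite index_uniq.
have nsx : since k.+1 x = false by rewrite /since idx ltnn.
apply: wp_seq; apply: vc_wp; rewrite /= r1 (ord_nth st kn) -/x; apply: wp_seq.
have ps2 : piece_state (set_reg s 2 x).
  by split; [apply: tree_state_reg | case: ps].
have hg : holds_graph N (set_reg s 2 x) by case: ps2.1.
apply: wp_mono (wp_for_adj (T := 4) (x := x) (J := fun l s' => forall c : 'I_n.+1,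
  arr s' 12 c = arr s 12 c + (pc x == c) * count (crossing (flip_of s) false x) l /\
  arr s' 13 c = arr s 13 c + (pc x == c) * count (crossing (flip_of s) true x) l)
  hg erefl _ _ _ _ _ _) => //=; last first.
- move=> l y l' s1 Nx inv1 r2 fr.
  have ps1 : piece_state s1.
    by split; [apply: tree_state_frame fr ps2.1 | move=> v; rewrite fr.2 ?ps.2].
  have fE : flip_of s1 =1 flip_of s by move=> v; rewrite /flip_of fr.2.
  apply: wp_mono (orient_scan_wp y ps1 r2 _) => [s' t [h tb]|v]; last first.
    by rewrite fE -f14 fr.2.
  split=> // c; have [-> ->] := h c; have [-> ->] := inv1 c.
  rewrite /= -!cats1 !count_cat /= !addn0 !mulnDr !addnA.
  by rewrite /crossing !fE.
- by move=> c; rewrite !muln0 !addn0.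
move=> s1 t1 [inv1 fr t1b].
have [_ _ _ p5 _] := st; have r2 : reg s1 2 = x by rewrite (fr.1 2).
have fE : flip_of s1 =1 flip_of s by move=> v; rewrite /flip_of fr.2.
have sinceE v : since k v = (v == x) || since k.+1 v by apply: since_step.
have fin s' : (forall v : 'I_n.+1, arr s' 12 v = arr s1 12 v) ->
    (forall v : 'I_n.+1, arr s' 13 v = arr s1 13 v) ->
    (forall v : 'I_n.+1, arr s' 14 v =
       if v == x then arr s1 12 x < arr s1 13 x : nat else arr s1 14 v) ->
    orient_inv k s'.
  move=> s12 s13 s14.
  have flE v : flip_of s' v = if v == x then arr s1 12 x < arr s1 13 x else flip_of s v.
    by rewrite /flip_of s14; case: (v =P x) => _; [case: (_ < _) | rewrite fr.2].
  (* Deciding [x] disturbs no earlier count: an edge from a scanned [y] into a piece with root [x]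
     would put [y] strictly before [x]. *)
  have cntE b y : since k y ->
      count (crossing (flip_of s') b y) (N y) = count (crossing (flip_of s) b y) (N y).
    move=> sy; apply: eq_in_count => u; rewrite NE => eyu.
    have [pux|/negPf npux] := eqVneq (pc u) x; last by rewrite /crossing flE npux.
    have no fl : crossing fl b y u = false.
      apply/negP => /(crossing_index eyu); rewrite pux idx.
      by move: sy; rewrite /since leqNgt => /negP.
    by rewrite !no.
  have tallyE c b : partial_tally (since k) (flip_of s') c b =
      partial_tally (since k.+1) (flip_of s) c b +
      (pc x == c) * count (crossing (flip_of s) b x) (N x).
    rewrite /partial_tally (eq_bigr (fun y => count (crossing (flip_of s) b y) (N y))); last first.
      by move=> y /andP[sy _]; apply: cntE.
    have [pxc|pxc] := eqVneq (pc x) c.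
      rewrite mul1n addnC (bigD1 x) /=; last by rewrite sinceE eqxx pxc eqxx.
      congr (_ + _); apply: eq_bigl => y; rewrite sinceE.
      by case: eqP => [->|_]; rewrite ?nsx ?andbF ?andbT.
    rewrite addn0; apply: eq_bigl => y; rewrite sinceE.
    by case: eqP => [->|//]; rewrite nsx (negPf pxc).
  split.
  - by move=> v; rewrite s14 flE; case: eqP => // _; rewrite fr.2 // f14.
  - move=> c; rewrite s12 s13 !tallyE; have [-> ->] := inv1 c.
    by have [-> ->] := tal c.
  - move=> c; rewrite sinceE s12 s13 flE; case: eqP => [-> //|_] /= sc.
    rewrite done //; have [-> ->] := inv1 c.
    (* [pc x] is not later than [x] in the preorder, so scanning [x] leaves the tallies of the
       decided [c] unchanged. *)
    have -> : (pc x == c) = false; last by rewrite !addn0.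
    apply/eqP => E; have := pc_index x; rewrite E idx.
    by move: sc; rewrite /since leqNgt ltnS => /negPf ->.
apply: vc_wp; rewrite /= r2.
have pE (v : 'I_n.+1) : (v == x) = (nat_of_ord v == x) by [].
case: ifPn => lt /=; (split; last by lia); apply: fin => v //=;
  by rewrite pE; case: eqP => // _; rewrite ?lt ?(negPf lt).
Qed.

Lemma orient_prog_wp s : piece_state s -> (forall b i, 12 <= b -> arr s b i = 0) ->
  wp orient_prog s (fun s' t =>
    [/\ piece_state s', frame orient_prog s s',
        forall v : 'I_n.+1, arr s' 14 v = flip_of s' v,
        forall c, flip_of s' c = (piece_tally e dep pc (flip_of s') c false
           < piece_tally e dep pc (flip_of s') c true) &
        t <= 7 * n.+1 + 7 * \sum_v size (N v) + 2]).
Proof.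
move=> ps zero; have st := ps.1; have rn : reg s 0 = n.+1 by case: st.
have psf s' : frame orient_prog s s' -> piece_state s'.
  move=> fr; split; first exact: tree_state_frame fr st.
  by move=> v; rewrite fr.2 ?ps.2.
apply: wp_mono (wp_for_down (J := orient_inv)
  (T := fun k => 5 + size (N (nth ord0 ord k)) * 7) rn _ _ _) => //=.
- move=> s' t [[f14 tal done] fr tb]; split=> //.
  + exact: psf.
  + move=> c; rewrite done //; have [-> ->] := tal c.
    congr (_ < _); apply: eq_bigr => y _; exact: count_N.
  + apply: leq_trans tb _.
    rewrite (eq_bigr (fun k : 'I_n.+1 => 7 + 7 * size (N (nth ord0 ord k)))); last first.
      by move=> k _; rewrite addnAC mulnC.
    rewrite big_split /= -big_distrr /= (sum_ord (fun v => size (N v))) sum_nat_const card_ord.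
    by rewrite [n.+1 * 7]mulnC addnC.
- have D0 v : since n.+1 v = false.
    by apply/negbTE; rewrite /since -ltnNge index_ord.
  split=> [v|c|c]; rewrite ?D0 // /flip_of /= !zero //.
  by rewrite /partial_tally !big_pred0 // => y; rewrite D0.
- move=> k s1 kn inv fr.
  have ps1 : piece_state (set_reg s1 1 k).
    have ps1 := psf _ fr; split; last by case: ps1.
    by apply: tree_state_reg => //; case: ps1.
  exact: orient_body_wp ps1 erefl inv.
Qed.

End Orient.

End Pieces.

End Passes.

(** * Choosing the better cut *)

Definition label_body : com :=
  Seq (If (Eq (Read 6 (Reg 1)) (Read 14 (Read 10 (Reg 1))))
          (Store 15 (Reg 1) (Const 0)) (Store 15 (Reg 1) (Const 1)))
      (If (Eq (Read 11 (Reg 1)) (Const 0))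
          (Store 16 (Reg 1) (Read 6 (Reg 1)))
          (If (Eq (Read 6 (Reg 1)) (Const 0))
              (Store 16 (Reg 1) (Const 1)) (Store 16 (Reg 1) (Const 0)))).

Definition label_prog : com := for_up 1 label_body.

Definition count_scan : com :=
  Seq (If (Eq (Read 15 (Reg 2)) (Read 15 (Reg 4))) (Assign 6 (Succ (Reg 6))) Skip)
      (If (Eq (Read 16 (Reg 2)) (Read 16 (Reg 4))) (Assign 7 (Succ (Reg 7))) Skip).

Definition count_prog : com :=
  Seq (Assign 6 (Const 0))
  (Seq (Assign 7 (Const 0))
       (for_up 1 (Seq (Assign 2 (Reg 1)) (for_adj count_scan)))).

Definition select_prog : com :=
  If (Lt (Reg 7) (Reg 6))
     (for_up 1 (Store 2 (Reg 1) (Read 16 (Reg 1))))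
     (for_up 1 (Store 2 (Reg 1) (Read 15 (Reg 1)))).

Section Selection.

Variables (n : nat) (N : 'I_n.+1 -> seq 'I_n.+1).

Definition label_inv (l1 l2 : 'I_n.+1 -> bool) (k : nat) (s : state) : Prop :=
  forall v : 'I_n.+1, v < k -> arr s 15 v = l1 v /\ arr s 16 v = l2 v.

Lemma label_prog_wp s (dep : 'I_n.+1 -> nat) (pc : 'I_n.+1 -> 'I_n.+1)
    (flip F : 'I_n.+1 -> bool) :
  reg s 0 = n.+1 -> agree s 6 (fun v : 'I_n.+1 => odd (dep v)) ->
  agree s 10 (fun v : 'I_n.+1 => pc v) -> agree s 14 (fun v : 'I_n.+1 => flip v) ->
  (forall v : 'I_n.+1, (arr s 11 v != 0) = F v) ->
  wp label_prog s (fun s' t =>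
    [/\ agree s' 15 (fun v : 'I_n.+1 => majority_label dep pc flip v),
        agree s' 16 (fun v : 'I_n.+1 => branch_label dep F v) &
        t <= 7 * n.+1 + 2]).
Proof.
move=> rn a6 a10 a14 a11.
apply: wp_mono (wp_for_up (n := n.+1)
  (J := label_inv (majority_label dep pc flip) (branch_label dep F))
  (T := fun=> 5) rn _ _ _ _ _) => //=.
- move=> s' t [h fr tb]; split; try by move=> v; have [] := h v (ltn_ord v).
  by apply: leq_trans tb _; rewrite sum_nat_const card_ord; lia.
- move=> k s1 kn inv r1 fr; set x : 'I_n.+1 := Ordinal kn.
  have fin s' : (forall v : 'I_n.+1, arr s' 15 v =
        if v == x :> nat then majority_label dep pc flip x : nat else arr s1 15 v) ->
      (forall v : 'I_n.+1, arr s' 16 v =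
        if v == x :> nat then branch_label dep F x : nat else arr s1 16 v) ->
      label_inv (majority_label dep pc flip) (branch_label dep F) k.+1 s'.
    move=> h15 h16 v; rewrite h15 h16 ltnS leq_eqVlt => /orP[/eqP vk|vk].
      have -> : v = x by apply: val_inj.
      by rewrite eqxx.
    by rewrite (ltn_eqF vk); apply: inv.
  have f6 : arr s1 6 k = odd (dep x) by rewrite fr.2 // (a6 x).
  have f10 : arr s1 10 k = pc x by rewrite fr.2 // (a10 x).
  have f14 v : arr s1 14 (pc v) = flip (pc v) by rewrite fr.2 // (a14 (pc v)).
  have f11 : (arr s1 11 k == 0) = ~~ F x by rewrite fr.2 // -(a11 x) negbK.
  apply: vc_wp; rewrite /= r1 f6 f10 f14; case: ifPn => /= h1;
    rewrite ?f11 ?f6; case: ifPn => h2; rewrite ?f6 /=;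
    try (case: ifPn => h3 /=); (split; last by []); apply: fin => v /=;
    case: eqP => // vk; move: h1 h2; rewrite /majority_label /branch_label; try move: h3;
    by case: (odd (dep x)); case: (flip (pc x)); case: (F x).
Qed.

Lemma count_prog_wp s (l1 l2 : 'I_n.+1 -> bool) :
  holds_graph N s -> reg s 0 = n.+1 ->
  agree s 15 (fun v : 'I_n.+1 => l1 v) -> agree s 16 (fun v : 'I_n.+1 => l2 v) ->
  wp count_prog s (fun s' t =>
    [/\ reg s' 6 = \sum_v count (fun y => l1 v == l1 y) (N v),
        reg s' 7 = \sum_v count (fun y => l2 v == l2 y) (N v) &
        t <= 5 * n.+1 + 7 * \sum_v size (N v) + 4]).
Proof.
move=> hg rn a15 a16; do 2!(apply: wp_seq; apply: vc_wp => /=).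
pose c1 k := \sum_(0 <= i < k) count (fun y => l1 (inord i) == l1 y) (N (inord i)).
pose c2 k := \sum_(0 <= i < k) count (fun y => l2 (inord i) == l2 y) (N (inord i)).
have sumE (f : 'I_n.+1 -> nat) : \sum_(0 <= i < n.+1) f (inord i) = \sum_v f v.
  by rewrite big_mkord; apply: eq_bigr => i _; rewrite inord_val.
have rn' : reg (set_reg (set_reg s 6 0) 7 0) 0 = n.+1 by [].
apply: wp_mono (wp_for_up (n := n.+1) (J := fun k s' => reg s' 6 = c1 k /\ reg s' 7 = c2 k)
  (T := fun k => 3 + size (N (inord k)) * 7) rn' _ _ _ _ _) => //=.
- have E : \sum_v (3 + size (N v) * 7 + 2) = 5 * n.+1 + 7 * \sum_v size (N v).
    rewrite (eq_bigr (fun v => 5 + 7 * size (N v))); last first.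
      by move=> k _; rewrite addnAC mulnC.
    by rewrite big_split /= -big_distrr /= sum_nat_const card_ord mulnC.
  move=> s' t [[-> ->] fr]; rewrite -(sumE (fun v => 3 + size (N v) * 7 + 2)) big_mkord in E.
  by rewrite E => tb; split; [rewrite -sumE | rewrite -sumE |
    rewrite [_ + 4]addnC; apply: leq_add (leqnn 2) tb].
- by rewrite /c1 /c2 !big_geq.
- move=> k s1 kn [h6 h7] r1 fr; set x : 'I_n.+1 := Ordinal kn.
  have xE : inord k = x by apply: val_inj; rewrite /= inordK.
  have fa b i : arr s1 b i = arr s b i by rewrite fr.2.
  apply: wp_seq; apply: vc_wp; rewrite /= r1.
  have hg1 : holds_graph N (set_reg s1 2 k).
    by move=> v /=; rewrite !fa; have [-> h] := hg v; split=> // i iN; rewrite fa h.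
  have rx : reg (set_reg s1 2 k) 2 = x by [].
  apply: wp_mono (wp_for_adj (T := 4) (x := x) (J := fun l s' =>
     reg s' 6 = c1 k + count (fun y => l1 x == l1 y) l /\
     reg s' 7 = c2 k + count (fun y => l2 x == l2 y) l) hg1 rx _ _ _ _ _ _) => //=.
  + move=> s2 t2 [[g6 g7] fr2 tb2]; split; last by rewrite xE; lia.
    by rewrite /c1 /c2 !big_nat_recr //= xE g6 g7.
  + by rewrite !addn0.
  + move=> l y l' s2 Nx [g6 g7] r2 fr2.
    have fa2 b i : arr s2 b i = arr s b i by rewrite fr2.2 // fa.
    have bE (a b : bool) : (a == b :> nat) = (a == b) by case: a; case: b.
    apply: vc_wp; rewrite /= r2 !fa2 (a15 x) (a15 y) (a16 x) (a16 y) !bE.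
    case: ifPn => e1; case: ifPn => e2 /=; (split; last by []);
    rewrite -!cats1 !count_cat /= ?e1 ?e2 ?(negPf e1) ?(negPf e2) g6 g7; lia.
Qed.

Lemma select_prog_wp s (l1 l2 : 'I_n.+1 -> bool) :
  reg s 0 = n.+1 ->
  agree s 15 (fun v : 'I_n.+1 => l1 v) -> agree s 16 (fun v : 'I_n.+1 => l2 v) ->
  wp select_prog s (fun s' t =>
    agree s' 2 (fun v : 'I_n.+1 => if reg s 7 < reg s 6 then l2 v else l1 v) /\
    t <= 3 * n.+1 + 3).
Proof.
move=> rn a15 a16; apply: wp_if => /=.
have copy b (l : 'I_n.+1 -> bool) : b != 2 -> agree s b (fun v : 'I_n.+1 => l v) ->
    wp (for_up 1 (Store 2 (Reg 1) (Read b (Reg 1)))) s (fun s' t =>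
      agree s' 2 (fun v : 'I_n.+1 => l v) /\ t <= 3 * n.+1 + 2).
  move=> b2 ab.
  apply: wp_mono (wp_for_up (n := n.+1)
    (J := fun k s' => forall v : 'I_n.+1, v < k -> arr s' 2 v = l v)
    (T := fun=> 1) rn _ _ _ _ _) => //=.
    move=> s' t [h _ tb]; split=> [v|]; first exact: h.
    by move: tb; rewrite sum_nat_const card_ord; lia.
  move=> k s1 kn inv r1 fr; apply: vc_wp => /=; split=> // v.
  rewrite r1 ltnS leq_eqVlt => /orP[/eqP vk|vk]; last by rewrite (ltn_eqF vk); apply: inv.
  by rewrite -vk eqxx fr.2 ?ab //= inE.
case c : (reg s 7 < reg s 6);
  [apply: wp_mono (copy 16 l2 isT a16) | apply: wp_mono (copy 15 l1 isT a15)];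
  by move=> s' t [h tb]; split=> [v|]; [exact: h | lia].
Qed.

End Selection.

(** * Input encoding and assembly of the program *)

Lemma nth_scanl_sumn m (s : seq nat) k : k <= size s ->
  nth 0 (m :: scanl addn m s) k = m + sumn (take k s).
Proof.
elim: s m k => [|x s IH] m [|k] //= ks; rewrite ?addn0 //.
by rewrite IH // addnA.
Qed.

Lemma nth_flatten_sumn (T : Type) (x0 : T) (ss : seq (seq T)) r c :
  r < size ss -> c < size (nth [::] ss r) ->
  nth x0 (flatten ss) (sumn (take r (shape ss)) + c) = nth x0 (nth [::] ss r) c.
Proof.
elim: ss r => [|s ss IH] [|r] //= rs cs; rewrite nth_cat ?add0n ?cs //.
by rewrite -addnA ltnNge leq_addr /= addKn IH.
Qed.

Lemma holds_graph_input n (N : 'I_n -> seq 'I_n) : holds_graph N (input_state N).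
Proof.
move=> v; set sz := [seq size (N u) | u <- enum 'I_n].
have szE : size sz = n by rewrite size_map size_enum_ord.
have offE k : k <= n -> arr (input_state N) 0 k = sumn (take k sz).
  by move=> kn; rewrite -[RHS]add0n -nth_scanl_sumn ?szE.
have shapeE : sz = shape [seq map val (N u) | u <- enum 'I_n].
  by rewrite /shape -map_comp; apply: eq_map => u /=; rewrite size_map.
have blockE : nth [::] [seq map val (N u) | u <- enum 'I_n] v = map val (N v).
  by rewrite (nth_map v) ?size_enum_ord // nth_ord_enum.
rewrite !offE // ?(ltnW (ltn_ord v)) //; split=> [|k kN].
  rewrite (take_nth 0) ?szE // sumn_rcons; congr (_ + _).
  by rewrite (nth_map v) ?size_enum_ord // nth_ord_enum.
have arr1 i : arr (input_state N) 1 i =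
    nth 0 (flatten [seq map val (N u) | u <- enum 'I_n]) i by [].
rewrite arr1 shapeE nth_flatten_sumn; first by rewrite blockE (nth_map v).
  by rewrite size_map size_enum_ord.
by rewrite blockE size_map.
Qed.

Definition maxcut_prog : com :=
  Seq dfs_prog (Seq low_prog (Seq piece_prog (Seq orient_prog
    (Seq label_prog (Seq count_prog select_prog))))).

Lemma count_uncut n (e : rel 'I_n) (N : 'I_n -> seq 'I_n) (dep : 'I_n -> nat) lab :
  symmetric e -> (forall x y, e x y -> dep x != dep y) -> adjacency_lists e N ->
  \sum_v count (fun y => lab v == lab y) (N v) = #|uncut e dep lab|.*2.
Proof.
move=> e_sym de adj; rewrite -(@up_pairs _ e dep e_sym de (fun x y => lab x == lab y)); last first.
  by move=> x y; rewrite eq_sym.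
apply: eq_bigr => v _; have [u NE] := adj v.
rewrite -size_filter -(card_uniqP _) ?filter_uniq //.
by apply: eq_card => x; rewrite mem_filter inE NE andbC.
Qed.

(** A constant labelling leaves every edge uncut. *)
Lemma sum_sizes n (e : rel 'I_n) (N : 'I_n -> seq 'I_n) (dep : 'I_n -> nat) :
  symmetric e -> (forall x y, e x y -> dep x != dep y) -> adjacency_lists e N ->
  \sum_v size (N v) = #|edges e|.*2.
Proof.
move=> e_sym de adj; rewrite (card_edges e_sym de).
transitivity (\sum_v count (fun y => true == true) (N v)).
  by apply: eq_bigr => v _; rewrite count_predT.
rewrite (count_uncut (fun=> true) e_sym de adj); congr _.*2.
by apply: eq_card => q; rewrite !inE andbT.
Qed.

Lemma maxcut_prog_wp n (e : rel 'I_n.+1) (N : 'I_n.+1 -> seq 'I_n.+1) :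
  symmetric e -> irreflexive e -> connected_graph e ->
  #|edges e| <= 2 * n.+1 -> adjacency_lists e N ->
  wp maxcut_prog (input_state N) (fun s t =>
    t <= 1000 * n.+1 /\
    exists2 l, #|cut e (output_side n.+1 s) (~: output_side n.+1 s)| + l = #|edges e| &
      forall A : {set 'I_n.+1}, exists2 k, #|cut e A (~: A)| + k = #|edges e| &
        l = 0 \/ 2 * #|edges e| * l + #|edges e| * n.+1
                 <= #|edges e| * #|edges e| + k * (#|edges e| + n.+1)).
Proof.
move=> e_sym e_irr conn mn adj; have NE v : N v =i e v by case: (adj v).
have N_uniq v : uniq (N v) by case: (adj v).
set s0 := input_state N.
have z0 b i : 3 <= b -> arr s0 b i = 0 by case: b => [|[|[|]]].
apply: wp_seq; apply: wp_mono (wp_frame (dfs_prog_wp e_sym NE conn (holds_graph_input N) erefl z0)).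
move=> s1 t1 [[[p [dep [ord [tree [[ord_uniq ord_all ord_parent] [a4 a5 a6 l7]]]]]] tb1] fr1].
have de := @dep_edge _ _ _ _ _ tree e_irr.
have sizes := sum_sizes e_sym de adj.
(* The passes rely on fresh arrays being zero; numbering the arrays in order of first use makes this
   a growing lower bound on the index. *)
have z1 b i : 8 <= b -> arr s1 b i = 0.
  by move=> b8; rewrite fr1.2 ?z0 //= ?inE; lia.
have st1 : tree_state N p dep ord s1.
  split=> //; first exact: holds_graph_frame fr1 (holds_graph_input N).
  by rewrite fr1.1.
apply: wp_seq; apply: wp_mono (low_prog_wp NE tree ord_uniq ord_all ord_parent st1 z1).
move=> s2 t2 [st2 fr2 low tb2].
have [req_lt req_ge req_at gP] := low_inv_end (fun v => isT) low.
have z2 b i : 10 <= b -> arr s2 b i = 0.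
  by move=> b10; rewrite fr2.2 ?z1 //= ?inE; lia.
have ld2 : low_done N p dep ord (fun v => arr s2 8 v) (fun v => arr s2 9 v != 0) s2 by [].
apply: wp_seq.
apply: wp_mono (piece_prog_wp tree ord_uniq ord_all ord_parent req_lt ld2 z2).
move=> s3 t3 [[st3 a8 a9] fr3 [pc [F [a10 pcE pc_root a11 [FE F_root]]]] tb3].
have z3 b i : 12 <= b -> arr s3 b i = 0.
  by move=> b12; rewrite fr3.2 ?z2 //= ?inE; lia.
have ps3 : piece_state N p dep ord pc s3 by [].
apply: wp_seq.
apply: wp_mono (orient_prog_wp e_sym NE N_uniq tree ord_uniq ord_all ord_parent
  req_lt pcE pc_root ps3 z3).
move=> s4 t4 [[st4 a10'] fr4 f14 flipE tb4].
have [hg4 rn4 _ _ [a6' _]] := st4.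
have a11' (v : 'I_n.+1) : (arr s4 11 v != 0) = F v by rewrite fr4.2 // a11.
apply: wp_seq; apply: wp_mono (wp_frame (label_prog_wp rn4 a6' a10' f14 a11')).
move=> s5 t5 [[a15 a16 tb5] fr5].
have hg5 : holds_graph N s5 by apply: holds_graph_frame fr5 hg4.
have rn5 : reg s5 0 = n.+1 by rewrite fr5.1.
apply: wp_seq; apply: wp_mono (wp_frame (count_prog_wp hg5 rn5 a15 a16)).
move=> s6 t6 [[c1 c2 tb6] fr6].
have rn6 : reg s6 0 = n.+1 by rewrite fr6.1.
have a15' : agree s6 15 (fun v : 'I_n.+1 => majority_label dep pc (flip_of s4) v).
  by move=> v; rewrite fr6.2.
have a16' : agree s6 16 (fun v : 'I_n.+1 => branch_label dep F v).
  by move=> v; rewrite fr6.2.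
apply: wp_mono (select_prog_wp rn6 a15' a16') => s7 t7 [out tb7].
split.
  (* The lists have total length [2m], at most [4 * n.+1], so the passes add up to at most
     [273 * n.+1 + 15]. *)
  move: tb1 tb2 tb3 tb4 tb5 tb6 tb7; rewrite sizes; lia.
(* Both counters hold twice the number of missed edges, so comparing them compares the cuts. *)
rewrite c1 c2 !(count_uncut _ e_sym de adj) ltn_double in out.
set l1 := majority_label _ _ _ in out; set l2 := branch_label _ _ in out.
exists (minn #|uncut e dep l1| #|uncut e dep l2|).
  rewrite -(cut_uncut e_sym de (output_side n.+1 s7)); congr (_ + _).
  have outE v : (v \in output_side n.+1 s7) =
      if #|uncut e dep l2| < #|uncut e dep l1| then l2 v else l1 v.
    by rewrite inE (out v); case: ifP => _; case: (_ v).
  by rewrite (eq_uncut e dep outE) minnC /minn; case: ifP.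
move=> A; exists #|uncut e dep (fun v => v \in A)|; first exact: cut_uncut.
have := better_label tree e_sym req_lt req_ge req_at gP pcE pc_root flipE FE F_root
  (fun v => v \in A).
by rewrite -(card_edges e_sym de) card_ord => /(_ mn).
Qed.

Local Open Scope ring_scope.

(* 1/2 + n/(2m) exceeds 1 exactly when m < n, that is, when the graph is a tree;
   no cut can achieve such a ratio, which is then to be read as 1: the output is
   a maximum cut. *)
Theorem theorem3 :
  exists (prog : com) (K : nat),
    forall (n : nat) (e : rel 'I_n) (N : 'I_n -> seq 'I_n),
      symmetric e -> irreflexive e -> connected_graph e ->
      (1 <= #|edges e| <= 2 * n)%N ->
      adjacency_lists e N ->
      exists (s : state) (t : nat),
        [/\ exec prog (input_state N) s t,
            (t <= K * n)%N
          & Num.min 1 (1 / 2%:R + n%:R / (2%:R * #|edges e|%:R)) * (mc e)%:R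
              <= #|cut e (output_side n s) (~: output_side n s)|%:R :> rat].
Proof.
exists maxcut_prog, 1000 => -[|n] e N e_sym e_irr conn /andP[m1 mn] adj.
  by case/card_gt0P: m1 => E /imsetP[[[]]].
have [s [t [ex [tb [l lE bound]]]]] := maxcut_prog_wp e_sym e_irr conn mn adj.
exists s, t; split=> //.
have [A mcE] : exists A : {set 'I_n.+1}, mc e = #|cut e A (~: A)|.
  have [|A mcE] := @bigop.eq_bigmax _ (fun A : {set 'I_n.+1} => #|cut e A (~: A)|).
    by apply/card_gt0P; exists set0.
  by exists A.
have [k kE H] := bound A.
have -> : mc e = (#|edges e| - k)%N by rewrite mcE -kE addnK.
have -> : #|cut e (output_side n.+1 s) (~: output_side n.+1 s)| = (#|edges e| - l)%N.
  by rewrite -lE addnK.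
by apply: ratio_bound => //; [rewrite -kE leq_addl | rewrite -lE leq_addl].
Qed.
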